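(* Let $u\in\mathcal V_A\cap H^1_0(\Omega)$ solve $-\mathcal L_Au=q$ in $\Omega$. If $C>C_A$, then $$\mathcal J_{A,q}^C(v)\ \ge\ \mathcal J_{A,q}^C(u)\qquad\text{for all } v\in\mathcal V_A,$$ and, for $v\in\mathcal V_A$, equality holds if and only if $v-u$ is a constant. Moreover, $$C_A\le\frac{C_P}{\sqrt\alpha}.$$
   Context: $\Omega\subset\mathbb R^d$ is a bounded connected Lipschitz domain; functions are real-valued; $\|v\|_0=\|v\|_{L^2(\Omega)}$. Let $A\in L^\infty(\Omega;\mathbb R^{d\times d})$ be symmetric and uniformly elliptic: there are constants $0<\alpha\le\beta$ with $\alpha|\xi|^2\le\xi^\top A(x)\xi\le\beta|\xi|^2$ for a.e. $x\in\Omega$ and all $\xi\in\mathbb R^d$. Define $\mathcal L_Av:=\nabla\cdot(A\nabla v)$ (in the distributional sense), the weighted seminorm $|v|_A:=\left(\int_\Omega A\nabla v\cdot\nabla v\,dx\right)^{1/2}$, and the space $\mathcal V_A:=\{v\in H^1(\Omega):\mathcal L_Av\in L^2(\Omega)\}$. Let $$\lambda_1^A:=\inf_{0\ne w\in H^1_0(\Omega)}\frac{|w|_A^2}{\|w\|_0^2},\qquad C_A:=(\lambda_1^A)^{-1/2}.$$ For $q\in L^2(\Omega)$ and $C>0$ define $\mathcal J_{A,q}^C(v)=C\|\mathcal L_Av+q\|_0+|v|_A$ for $v\in\mathcal V_A$. The constant $C_P$ is the sharp Dirichlet Poincaré constant: $C_P:=\sup_{0\ne w\in H^1_0(\Omega)}\|w\|_0/\|\nabla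 w\|_{L^2(\Omega)}$. *)

(* Defs.v *)
From HB Require Import structures.
From mathcomp Require Import all_boot all_order all_algebra.
From mathcomp Require Import all_classical all_reals all_analysis.
Set Implicit Arguments.
Unset Strict Implicit.
Unset Printing Implicit Defensive.
Import Order.TTheory GRing.Theory Num.Theory.
Import numFieldNormedType.Exports.
Local Open Scope classical_set_scope.
Local Open Scope ring_scope.

Definition measure_rV_display : measure_display.
Proof. exact: default_measure_display. Qed.

(* The sigma-algebra on 'rV[R]_n is the one generated by the coordinates, as  *)
(* the library does for n.-tuple R; it is the Borel sigma-algebra of R^n.     *)
Section measurable_rV.
Context {R : realType}.
Variable n : nat.

Definition rV_coor (i : 'I_n) (x : 'rV[R]_n) : R := x ord0 i.

Let rV_set0 : g_sigma_preimage rV_coor set0.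
Proof. exact: sigma_algebra0. Qed.

Let rV_setC A : g_sigma_preimage rV_coor A -> g_sigma_preimage rV_coor (~` A).
Proof. exact: sigma_algebraC. Qed.

Let rV_bigcup (F : (set 'rV[R]_n)^nat) :
  (forall i, g_sigma_preimage rV_coor (F i)) ->
  g_sigma_preimage rV_coor (\bigcup_i (F i)).
Proof. exact: sigma_algebra_bigcup. Qed.

HB.instance Definition _ := @isMeasurable.Build measure_rV_display
  'rV[R]_n (g_sigma_preimage rV_coor) rV_set0 rV_setC rV_bigcup.

End measurable_rV.

Lemma measurable_rV_coor (R : realType) n (i : 'I_n) :
  measurable_fun [set: 'rV[R]_n] (@rV_coor R n i).
Proof.
move=> _ Y mY; rewrite setTI; apply: sub_sigma_algebra => /=.
rewrite -bigcup_seq/=; exists i => /=; first by rewrite mem_index_enum.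
by exists Y => //; rewrite setTI.
Qed.

Lemma measurable_fun_rVP (R : realType) d (T : measurableType d) n
    (f : T -> 'rV[R]_n) :
  (forall i, measurable_fun [set: T] (@rV_coor R n i \o f)) ->
  measurable_fun [set: T] f.
Proof.
move=> mf; suff H : g_sigma_preimage (fun i => @rV_coor R n i \o f) `<=` measurable.
  move: H; rewrite g_sigma_preimage_comp => prefS.
  by move=> _ A mA; apply: prefS; exists A.
apply: smallest_sub; first exact: sigma_algebra_measurable.
case: n f mf => [|n] f mf; first by rewrite big_ord0.
rewrite -bigcup_mkord_ord; apply: bigcup_sub => i Ii.
by move=> A [B mB <-]; exact: mf.
Qed.

Definition rV_cons (R : realType) n (p : measurableTypeR R * 'rV[R]_n) :
    'rV[R]_n.+1 :=
  row_mx (const_mx (p.1 : R) : 'rV[R]_1) p.2.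

Lemma measurable_rV_cons (R : realType) n :
  measurable_fun [set: measurableTypeR R * 'rV[R]_n] (@rV_cons R n).
Proof.
apply: measurable_fun_rVP => i.
rewrite -[i](@splitK 1 n); case: (@fintype.split 1 n i) => j.
  rewrite (_ : _ \o _ = fst); first exact: measurable_fst.
  by apply/funext => p; rewrite /= /rV_coor /rV_cons (@row_mxEl R 1 1 n) mxE.
rewrite (_ : _ \o _ = @rV_coor R n j \o snd).
  exact: (measurableT_comp (measurable_rV_coor j) measurable_snd).
by apply/funext => p; rewrite /= /rV_coor /rV_cons (@row_mxEr R 1 1 n).
Qed.

Section lebesgue_rV_cons.
Context {R : realType} {n : nat}.
Variable m : {sigma_finite_measure set 'rV[R]_n -> \bar R}.

Definition lebesgue_rV_cons : set 'rV[R]_n.+1 -> \bar R :=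
  pushforward (@lebesgue_measure R \x m)%E (@rV_cons R n).

Let preim (A : set 'rV[R]_n.+1) :
  measurable A -> measurable (@rV_cons R n @^-1` A).
Proof. by move=> mA; rewrite -[X in measurable X]setTI; exact: measurable_rV_cons. Qed.

Let lebesgue_rV_cons0 : lebesgue_rV_cons set0 = 0%E.
Proof. by rewrite /lebesgue_rV_cons /pushforward preimage_set0 measure0. Qed.

Let lebesgue_rV_cons_ge0 A : (0 <= lebesgue_rV_cons A)%E.
Proof. by rewrite /lebesgue_rV_cons /pushforward; exact: measure_ge0. Qed.

Let lebesgue_rV_cons_sigma_additive : semi_sigma_additive lebesgue_rV_cons.
Proof.
move=> F mF tF mUF; rewrite /lebesgue_rV_cons /pushforward preimage_bigcup.
apply: measure_semi_sigma_additive.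
- by move=> k; exact: preim.
- apply/trivIsetP => /= i j _ _ ij; rewrite -preimage_setI.
  by move/trivIsetP : tF => /(_ _ _ _ _ ij) ->//; rewrite preimage_set0.
- by rewrite -preimage_bigcup; exact: preim.
Qed.

HB.instance Definition _ := isMeasure.Build _ _ _ lebesgue_rV_cons
  lebesgue_rV_cons0 lebesgue_rV_cons_ge0 lebesgue_rV_cons_sigma_additive.

Let uncons (x : 'rV[R]_n.+1) : measurableTypeR R * 'rV[R]_n :=
  (rV_coor ord0 x, \row_j rV_coor (lift ord0 j) x).

Let unconsK : cancel (@rV_cons R n) uncons.
Proof.
move=> [t x]; rewrite /uncons /rV_coor /rV_cons; congr pair => /=.
  rewrite (_ : ord0 = @lshift 1 n ord0); last exact/val_inj.
  by rewrite (@row_mxEl R 1 1 n) mxE.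
apply/rowP => j; rewrite mxE (_ : lift ord0 j = @rshift 1 n j).
  by rewrite (@row_mxEr R 1 1 n).
exact/val_inj.
Qed.

Let measurable_uncons : measurable_fun [set: 'rV[R]_n.+1] uncons.
Proof.
apply: measurable_fun_pair; first exact: measurable_rV_coor.
apply: measurable_fun_rVP => j.
rewrite (_ : _ \o _ = rV_coor (lift ord0 j)); first exact: measurable_rV_coor.
by apply/funext => x; rewrite /= {1}/rV_coor mxE.
Qed.

Let lebesgue_rV_cons_sigma_finite : sigma_finite setT lebesgue_rV_cons.
Proof.
have /sigma_finiteP[F [TF ndF Foo]] := sigma_finiteT (@lebesgue_measure R).
have /sigma_finiteP[G [TG ndG Goo]] := sigma_finiteT m.
exists (fun k => uncons @^-1` (F k `*` G k)).
  rewrite -preimage_bigcup -[LHS](preimage_setT uncons); congr (_ @^-1` _).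
  rewrite -setXTT TF TG predeqE => -[x y]; split.
    move=> [/= [i _ Fix] [k _ Gky]]; exists (maxn i k) => //; split.
    - by move: x Fix; exact/subsetPset/ndF/leq_maxl.
    - by move: y Gky; exact/subsetPset/ndG/leq_maxr.
  by move=> [i _ []/= ? ?]; split; exists i.
move=> k; have [? ?] := Foo k; have [? ?] := Goo k; split.
  rewrite -[X in measurable X]setTI; apply: measurable_uncons => //.
  exact: measurableX.
rewrite /lebesgue_rV_cons /pushforward -comp_preimage.
rewrite (_ : uncons \o _ = id); last by apply/funext => p /=; rewrite unconsK.
rewrite preimage_id product_measure1E//.
by rewrite lte_mul_pinfty// ge0_fin_numE.
Qed.

HB.instance Definition _ := Measure_isSigmaFinite.Build _ _ _ lebesgue_rV_cons
  lebesgue_rV_cons_sigma_finite.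

End lebesgue_rV_cons.

Fixpoint lebesgue_rV (R : realType) (n : nat) :
    {sigma_finite_measure set 'rV[R]_n -> \bar R} :=
  match n with
  | 0 => \d_(0 : 'rV[R]_0)
  | k.+1 => lebesgue_rV_cons (lebesgue_rV R k)
  end.

Section euclidean.
Context {R : realType} {n : nat}.
Implicit Types (x y : 'rV[R]_n).

Definition dot x y : R := \sum_i x ord0 i * y ord0 i.
(* The library norm on 'rV[R]_n is the sup norm. *)
Definition enorm x : R := Num.sqrt (dot x x).

End euclidean.

(* The ambient dimension is n.+1 >= 1; near a boundary point, after an         *)
(* orthogonal change of coordinates, the set is the strict epigraph of a       *)
(* Lipschitz function of the n coordinates other than the last one.            *)
Definition lipschitz_boundary (R : realType) n (Omega : set 'rV[R]_n.+1) :=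
  forall x, (closure Omega `\` interior Omega) x ->
  exists (Q : 'M[R]_n.+1) (r L : R) (gamma : 'rV[R]_n -> R),
    [/\ Q *m Q^T = 1%:M, 0 < r,
        forall y z, `|gamma y - gamma z| <= L * enorm (y - z) &
        forall y, ball x r y ->
          let y' := y *m Q in
          Omega y <->
          gamma (\row_(j < n) y' ord0 (lift ord_max j)) < y' ord0 ord_max].

Definition bounded_lipschitz_domain (R : realType) n
    (Omega : set 'rV[R]_n.+1) :=
  [/\ open Omega, connected Omega, Omega !=set0, bounded_set Omega &
      lipschitz_boundary Omega].

(* Functions and vector fields on Omega are represented by functions on the    *)
(* whole space whose values outside Omega are irrelevant.                      *)
Section sobolev.
Context {R : realType} {n : nat}.
Local Notation E := 'rV[R]_n.
Local Notation mu := (lebesgue_rV R n).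
Variable Omega : set E.
Implicit Types (v f : E -> R) (G : E -> E).

Definition in_Lp (p : \bar R) v := (v \_ Omega : E -> R) \in Lfun mu p.

Definition norm0 v : \bar R := 'N[mu]_2%:E[EFin \o (v \_ Omega)]%E.

Definition partial (i : 'I_n) f : E -> R := fun x => 'D_(delta_mx ord0 i) f x.

Definition smooth f := forall s : seq 'I_n,
  let g := foldr partial f s in
  continuous g /\ forall i x, derivable g x (delta_mx ord0 i).

Definition test_fun f :=
  let S := closure [set x | f x != 0] in
  [/\ smooth f, compact S & S `<=` Omega].

Definition gradient f : E -> E := fun x => \row_i partial i f x.

Definition weak_gradient_spec v G :=
  (forall i, in_Lp 2%:E (fun x => G x ord0 i)) /\
  (forall phi i, test_fun phi ->
     \int[mu]_(x in Omega) (v x * partial i phi x) =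
     - \int[mu]_(x in Omega) (G x ord0 i * phi x)).

Definition H1 : set (E -> R) :=
  [set v | in_Lp 2%:E v /\ exists G, weak_gradient_spec v G].

(* Meaningful for v in H1, where it is determined a.e. on Omega. *)
Definition wgrad v : E -> E := get (weak_gradient_spec v).

(* The L2 norm of a vector field, for the Euclidean norm. *)
Definition norm0_vec G : \bar R := norm0 (fun x => enorm (G x)).

Definition H10 : set (E -> R) :=
  [set v | H1 v /\ forall e : R, 0 < e -> exists phi, [/\ test_fun phi,
     (norm0 (fun x => v x - phi x)%R < e%:E)%E &
     (norm0_vec (fun x => wgrad v x - gradient phi x)%R < e%:E)%E]].

Definition ae_zero v := v = cst 0 %[ae mu in Omega].

(* Sharp Dirichlet Poincare constant, with 1 / 0 = +oo. *)
Definition poincare_cst : \bar R :=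
  ereal_sup [set (norm0 w / norm0_vec (wgrad w))%E | w in
    [set w | H10 w /\ ~ ae_zero w]].

Variable A : E -> 'M[R]_n.

Definition uniformly_elliptic (alpha beta : R) :=
  {ae mu, forall x, Omega x -> forall xi : E,
     alpha * enorm xi ^+ 2 <= (xi *m A x *m xi^T) ord0 ord0
       <= beta * enorm xi ^+ 2}.

(* Row-vector form of A(x) xi. *)
Definition flux G : E -> E := fun x => G x *m (A x)^T.

Definition LA_spec v f :=
  in_Lp 2%:E f /\
  forall phi, test_fun phi ->
    \int[mu]_(x in Omega) (f x * phi x) =
    - \int[mu]_(x in Omega) dot (flux (wgrad v) x) (gradient phi x).

Definition VA : set (E -> R) := [set v | H1 v /\ exists f, LA_spec v f].

(* Meaningful for v in VA, where it is determined a.e. on Omega. *)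
Definition LA v : E -> R := get (LA_spec v).

Definition seminormA v : \bar R :=
  sqrte (\int[mu]_(x in Omega) (dot (flux (wgrad v) x) (wgrad v x))%:E)%E.

Definition lambda1 : \bar R :=
  ereal_inf [set (seminormA w ^+ 2 / norm0 w ^+ 2)%E | w in
    [set w | H10 w /\ ~ ae_zero w]].

(* lambda1 ^ (-1/2), with 0^-1 = +oo. *)
Definition CA : \bar R := ((sqrte lambda1)^-1)%E.

Definition J (C : R) (q v : E -> R) : \bar R :=
  (C%:E * norm0 (fun x => (LA v x + q x)%R) + seminormA v)%E.

End sobolev.

(* Main.v *)
Require Import Defs.
From HB Require Import structures.
From mathcomp Require Import all_boot all_order all_algebra.
From mathcomp Require Import all_classical all_reals all_analysis.
From mathcomp Require Import measurable_realfun ess_sup_inf lra ring.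
Set Implicit Arguments.
Unset Strict Implicit.
Unset Printing Implicit Defensive.
Import Order.TTheory GRing.Theory Num.Theory.
Import numFieldNormedType.Exports.
Local Open Scope classical_set_scope.
Local Open Scope ring_scope.

(** Write a(G, H) for the energy form, the integral of A G . H, and f for the
    residual LA v + q, which is LA v - LA u almost everywhere. Green's formula
    against u, which lies in H10 (lemma green), gives the splitting
      a(grad u, grad u) = a(grad v, grad u) + (f, u)
    of lemma energy_solution. Cauchy-Schwarz and the bound of the norm of u by
    C' |u|_A, where C' < C is the value of CA, turn it into
      |u|_A <= |v|_A + C' |f|,
    which is the inequality because J(u) = |u|_A. If equality holds in
    J(v) >= J(u), then (C - C') |f| <= 0, so f = 0 and |v|_A = |u|_A; the
    splitting then gives a(grad v - grad u, grad v - grad u) = 0, ellipticity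
    gives grad v = grad u, and a function with zero weak gradient on a
    connected open set is constant. Conversely, if v - u is constant, the weak
    gradients agree, hence so do LA v and LA u, and both terms of J agree.

    The analytic facts behind this argument are proved with tensor products of
    smooth functions of one variable as test functions.
    - Fundamental lemma (ae_eq0_box, ae_eq0_open): tensors of smooth steps
      converge to indicators of boxes, and boxes generate the sigma-algebra.
    - Integration by parts (integral_partial): Fubini and the fundamental
      theorem of calculus in the coordinate of differentiation.
    - Zero weak gradient (weakly_cst_ae, connected_ae_cst): a smooth function
      of one variable supported in an interval is a multiple of a fixed bump
      plus the derivative of a smooth function supported there. A function
      with zero weak gradient does not see the derivative, so the factors of a
      tensor can be replaced one at a time by bumps; up to a factor depending
      on the tensor only, its integral against any tensor is thus its integral
      against one fixed tensor. This is also true of the function 1, and the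
      difference with a suitable constant is orthogonal to all tensors.

    For the bound of CA, ellipticity compares the seminorm with the norm of the
    gradient in every Rayleigh quotient; a bump shows that the supremum which
    defines the Poincare constant is not taken over the empty set. *)

(** * Boxes in the space of row vectors *)

Section boxes.
Context {R : realType}.

Definition box n (I : 'I_n -> set R) : set 'rV[R]_n :=
  [set x | forall i, I i (x ord0 i)].

Definition obox n (a b : 'I_n -> R) : set 'rV[R]_n :=
  box (fun i => `]a i, b i[%classic).

Definition cbox n (a b : 'I_n -> R) : set 'rV[R]_n :=
  box (fun i => `[a i, b i]%classic).

Lemma oboxE n (a b : 'I_n -> R) (x : 'rV[R]_n) :
  obox a b x <-> forall i, a i < x ord0 i < b i.
Proof. by split=> h i; move: (h i); rewrite /= in_itv. Qed.

Lemma cboxE n (a b : 'I_n -> R) (x : 'rV[R]_n) :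
  cbox a b x <-> forall i, a i <= x ord0 i <= b i.
Proof. by split=> h i; move: (h i); rewrite /= in_itv. Qed.

Lemma oboxI n (p q p' q' : 'I_n -> R) :
  obox p q `&` obox p' q' =
  obox (fun j => Num.max (p j) (p' j)) (fun j => Num.min (q j) (q' j)).
Proof.
apply/seteqP; split => x.
  move=> [/oboxE h /oboxE h']; apply/oboxE => j.
  rewrite gt_max lt_min; have /andP[-> ->] := h j.
  by have /andP[-> ->] := h' j.
move=> /oboxE h; split; apply/oboxE => j; have := h j;
by rewrite gt_max lt_min => /andP[/andP[h1 h2] /andP[h3 h4]]; rewrite ?h1 ?h2 ?h3 ?h4.
Qed.

Lemma sub_obox_cbox n (a b : 'I_n -> R) : obox a b `<=` cbox a b.
Proof.
by move=> x /oboxE h; apply/cboxE => i; have /andP[/ltW-> /ltW->] := h i.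
Qed.

Lemma measurable_box n (I : 'I_n -> set R) :
  (forall i, measurable (I i)) -> measurable (box I).
Proof.
move=> mI.
rewrite (_ : box I = ~` \bigcup_i (@rV_coor R n i @^-1` (~` I i))).
  apply: measurableC; apply: countable_bigcupT_measurable => // i.
  rewrite -[X in measurable X]setTI; apply: measurable_rV_coor => //.
  exact: measurableC.
apply/seteqP; split => x /=; first by move=> xI -[i _] /=; apply; exact: xI.
by move=> h i; apply: contrapT => xi; apply: h; exists i.
Qed.

Lemma measurable_obox n (a b : 'I_n -> R) : measurable (obox a b).
Proof. by apply: measurable_box => i; exact: measurable_itv. Qed.

Lemma measurable_cbox n (a b : 'I_n -> R) : measurable (cbox a b).
Proof. by apply: measurable_box => i; exact: measurable_itv. Qed.

Lemma open_obox n (a b : 'I_n -> R) : open (obox a b).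
Proof.
rewrite (_ : obox a b =
    ~` \bigcup_(i in [set` enum 'I_n])
      ((fun x : 'rV[R]_n => x ord0 i) @^-1` (~` `]a i, b i[%classic))).
  apply: closed_openC; rewrite bigcup_seq; apply: closed_bigsetU => i _.
  apply: closed_comp => [x _|]; first exact: coord_continuous.
  exact/open_closedC/itv_open.
apply/seteqP; split => x /=; first by move=> xI -[i _] /=; apply; exact: xI.
move=> h i; apply: contrapT => xi; apply: h; exists i => //=.
by rewrite mem_enum.
Qed.

Lemma compact_cbox n (a b : 'I_n -> R) : compact (cbox a b).
Proof. by apply: rV_compact => i; exact: segment_compact. Qed.

(** The closed box stays inside the open set, so that functions supported in
    it are admissible tests there. *)
Lemma open_rat_cbox n (O : set 'rV[R]_n) x : open O -> O x ->
  exists p q : {ffun 'I_n -> rat},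
    obox (ratr \o p) (ratr \o q) x /\ cbox (ratr \o p) (ratr \o q) `<=` O.
Proof.
move=> oO Ox; have /nbhs_ballP[e /= e0 xeO] : nbhs x O by exact: open_nbhs_nbhs.
have /choice[p hp] : forall i, exists r, ratr r \in `](x ord0 i - e), (x ord0 i)[.
  by move=> i; have [r] := @rat_in_itvoo R (x ord0 i - e) (x ord0 i) ltac:(lra); exists r.
have /choice[q hq] : forall i, exists r, ratr r \in `](x ord0 i), (x ord0 i + e)[.
  by move=> i; have [r] := @rat_in_itvoo R (x ord0 i) (x ord0 i + e) ltac:(lra); exists r.
exists [ffun i => p i], [ffun i => q i]; split.
  apply/oboxE => i /=; rewrite !ffunE.
  by have := hp i; have := hq i; rewrite !in_itv /=; lra.
move=> y /cboxE /= h; apply: xeO; split => // i j; rewrite ord1.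
have := h j; have := hp j; have := hq j; rewrite !ffunE !in_itv /=.
by rewrite /ball /= ltr_norml; lra.
Qed.

(** The sigma-algebra is generated by the coordinates, not by the open sets;
    countability of the rational boxes is what makes open sets measurable. *)
Lemma open_bigcup_rat_obox n (O : set 'rV[R]_n) : open O ->
  O = \bigcup_(pq in [set pq : {ffun 'I_n -> rat} * {ffun 'I_n -> rat} |
        cbox (ratr \o pq.1) (ratr \o pq.2) `<=` O])
      obox (ratr \o pq.1) (ratr \o pq.2).
Proof.
move=> oO; apply/seteqP; split => [x Ox|x [pq /= pqO]].
  by have [p [q [xpq pqO]]] := open_rat_cbox oO Ox; exists (p, q).
by move=> /sub_obox_cbox; exact: pqO.
Qed.

Lemma measurable_open_rV n (O : set 'rV[R]_n) : open O -> measurable O.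
Proof.
move=> /open_bigcup_rat_obox ->; rewrite bigcup_mkcond.
apply: countable_bigcupT_measurable => // pq; case: ifP => // _.
exact: measurable_obox.
Qed.

Lemma continuous_measurable_rV n (f : 'rV[R]_n -> R) :
  continuous f -> measurable_fun setT f.
Proof.
move=> /continuousP cf; apply: (measurability _ (RGenOpens.measurableE R)).
move=> _ [_ [a [b ->] <-]]; rewrite setTI; apply: measurable_open_rV.
exact/cf/interval_open.
Qed.

Lemma rV_cons0 n (t : R) (x : 'rV[R]_n) : rV_cons (t, x) ord0 ord0 = t.
Proof.
rewrite /rV_cons (_ : @ord0 n = @lshift 1 n ord0) ?(@row_mxEl R 1 1 n) ?mxE //.
exact/val_inj.
Qed.

Lemma rV_consS n (t : R) (x : 'rV[R]_n) i :
  rV_cons (t, x) ord0 (lift ord0 i) = x ord0 i.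
Proof.
rewrite /rV_cons (_ : lift ord0 i = @rshift 1 n i) ?(@row_mxEr R 1 1 n) //.
exact/val_inj.
Qed.

Lemma lebesgue_rV_boxS n (I : 'I_n.+1 -> set R) : (forall i, measurable (I i)) ->
  lebesgue_rV R n.+1 (box I) =
  (lebesgue_measure (I ord0) * lebesgue_rV R n (box (fun i => I (lift ord0 i))))%E.
Proof.
move=> mI /=; rewrite /lebesgue_rV_cons /pushforward.
rewrite (_ : _ @^-1` _ = I ord0 `*` box (fun i => I (lift ord0 i))).
  rewrite product_measure1E; [by []|exact: mI|exact: measurable_box].
apply/seteqP; split => -[t x] /=.
  move=> h; split => [|i]; first by have := h ord0; rewrite rV_cons0.
  by have := h (lift ord0 i); rewrite rV_consS.
move=> [It Ix] i; case: (unliftP ord0 i) => [j|] ->.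
  by rewrite rV_consS; exact: Ix.
by rewrite rV_cons0.
Qed.

Lemma lebesgue_rV_box0 (I : 'I_0 -> set R) : lebesgue_rV R 0 (box I) = 1%E.
Proof.
by rewrite /= diracE mem_set // => -[].
Qed.

Lemma lebesgue_rV_obox_gt0 n (a b : 'I_n -> R) : (forall i, a i < b i) ->
  (0 < lebesgue_rV R n (obox a b))%E.
Proof.
elim: n a b => [|n ih] a b ab; first by rewrite /obox lebesgue_rV_box0.
rewrite /obox lebesgue_rV_boxS; last by move=> i; exact: measurable_itv.
apply: mule_gt0; last first.
  by apply: (ih (a \o lift ord0) (b \o lift ord0)) => i /=; exact: ab.
by rewrite lebesgue_measure_itv /= lte_fin ab -EFinB lte_fin subr_gt0.
Qed.

Lemma lebesgue_rV_cbox_lty n (a b : 'I_n -> R) :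
  (lebesgue_rV R n (cbox a b) < +oo)%E.
Proof.
elim: n a b => [|n ih] a b; first by rewrite /cbox lebesgue_rV_box0 ltry.
rewrite /cbox lebesgue_rV_boxS; last by move=> i; exact: measurable_itv.
apply: lte_mul_pinfty => //; last exact: (ih (a \o lift ord0) (b \o lift ord0)).
by rewrite lebesgue_measure_itv /=; case: ifP.
Qed.

Lemma coord_le_norm n (x : 'rV[R]_n) i : `|x ord0 i| <= `|x|.
Proof.
rewrite [leRHS]/Num.norm /= mx_normrE.
by apply/bigmax_geP; right => /=; exists (ord0, i).
Qed.

Lemma bounded_sub_cbox n (D : set 'rV[R]_n) : bounded_set D ->
  exists2 M : R, 0 < M & D `<=` cbox (fun=> - M) (fun=> M).
Proof.
move=> [M [Mreal DM]]; exists (Num.max M 0 + 1).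
  by rewrite ltr_wpDl // le_max lexx orbT.
move=> x Dx; apply/cboxE => i; rewrite -ler_norml.
apply: le_trans (coord_le_norm x i) _; apply: DM => //.
by rewrite (@le_lt_trans _ _ (Num.max M 0)) ?ltrDl // le_max lexx.
Qed.

Lemma bounded_lebesgue_rV_lty n (D : set 'rV[R]_n) : measurable D ->
  bounded_set D -> (lebesgue_rV R n D < +oo)%E.
Proof.
move=> mD /bounded_sub_cbox[M _ DM].
apply: (@le_lt_trans _ _ (lebesgue_rV R n (cbox (fun=> - M) (fun=> M)))).
  by apply: le_measure => //; rewrite inE //; exact: measurable_cbox.
exact: lebesgue_rV_cbox_lty.
Qed.

(** Open boxes generate the sigma-algebra, because an open slab is an
    increasing union of boxes that are large in the other coordinates. *)
Lemma measurable_rV_gen_obox n :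
  @measurable _ 'rV[R]_n =
  <<s [set B | exists a b : 'I_n -> R, B = obox a b] >>.
Proof.
set G := [set _ | _]; apply/seteqP; split; last first.
  apply: smallest_sub; first exact: sigma_algebra_measurable.
  by move=> _ [a [b ->]]; exact: measurable_obox.
pose T := g_sigma_algebraType G.
have mcoor (i : 'I_n) : measurable_fun [set: T] (@rV_coor R n i : T -> R).
  apply: (measurability _ (RGenOpens.measurableE R)).
  move=> _ [_ [c [d ->]] <-]; rewrite setTI.
  rewrite (_ : _ @^-1` _ = \bigcup_k obox
    (fun j => if j == i then c else - k%:R) (fun j => if j == i then d else k%:R)).
    apply: bigcupT_measurable => k; apply: sub_sigma_algebra.
    by eexists; eexists; reflexivity.
  apply/seteqP; split => x /=.
    rewrite in_itv /= => xi; exists (Num.trunc `|x|).+1 => //; apply/oboxE => j.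
    case: eqP => [->|_] //; rewrite -ltr_norml.
    exact: le_lt_trans (coord_le_norm x j) (truncnS_gt _).
  by move=> [k _ /oboxE /(_ i)]; rewrite eqxx in_itv.
rewrite /measurable /=; apply: smallest_sub; first exact: smallest_sigma_algebra.
elim/big_ind : _ => [//|A B hA hB|i _]; first by rewrite subUset.
move=> _ [Y mY <-]; exact: mcoor.
Qed.

End boxes.

(** * Smooth functions of one variable *)

Section smooth1.
Context {R : realType}.
Implicit Types (f g : R -> R) (x y a b c d : R).

(** Each derivative is given existentially, so that closure properties are
    plain inductions on the order k. *)
Fixpoint Ck (k : nat) f : Prop :=
  if k is k'.+1 then exists2 g, (forall x, is_derive x 1 f (g x)) & Ck k' g
  else True.

Definition smooth1 f := forall k, Ck k f.

Lemma CkS k f : Ck k.+1 f -> Ck k f.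
Proof. by elim: k f => // k ih f [g fg /ih Cg]; exists g. Qed.

Lemma Ck_cst k c : Ck k (fun=> c).
Proof.
elim: k c => // k ih c; exists (fun=> 0) => //.
by move=> x; exact: is_derive_cst.
Qed.

Lemma CkD k f g : Ck k f -> Ck k g -> Ck k (fun x => f x + g x).
Proof.
elim: k f g => // k ih f g [f' ff' Cf'] [g' gg' Cg'].
exists (fun x => f' x + g' x); last exact: ih.
by move=> x; exact: is_deriveD.
Qed.

Lemma CkM k f g : Ck k f -> Ck k g -> Ck k (fun x => f x * g x).
Proof.
elim: k f g => // k ih f g Cf Cg; have [f' ff' Cf'] := Cf.
have [g' gg' Cg'] := Cg; exists (fun x => f x * g' x + g x * f' x).
  by move=> x; exact: is_deriveM.
by apply: CkD; apply: ih => //; exact: CkS.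
Qed.

Lemma Ck_affine k f c d : Ck k f -> Ck k (fun x => f (c * x + d)).
Proof.
elim: k f => // k ih f [f' ff' Cf']; exists (fun x => f' (c * x + d) * c).
  move=> x.
  have cd : is_derive x 1 (fun x : R => c * x + d) c.
    have -> : (fun x : R => c * x + d) = (c \*: id) + cst d by [].
    by apply: is_derive_eq; rewrite addr0 /GRing.scale /= mulr1.
  exact: (@is_derive1_comp _ f (fun x => c * x + d)).
by apply: CkM; [exact: ih|exact: Ck_cst].
Qed.

Lemma smooth1_cst c : smooth1 (fun=> c).
Proof. by move=> k; exact: Ck_cst. Qed.

Lemma smooth1D f g : smooth1 f -> smooth1 g -> smooth1 (fun x => f x + g x).
Proof. by move=> sf sg k; exact: CkD. Qed.

Lemma smooth1M f g : smooth1 f -> smooth1 g -> smooth1 (fun x => f x * g x).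
Proof. by move=> sf sg k; exact: CkM. Qed.

Lemma smooth1_affine f c d : smooth1 f -> smooth1 (fun x => f (c * x + d)).
Proof. by move=> sf k; exact: Ck_affine. Qed.

Lemma smooth1_is_derive f : smooth1 f -> forall x, is_derive x 1 f (derive1 f x).
Proof.
move=> /(_ 1%N)[g fg _] x; have [dfx e] := fg x.
by apply: (DeriveDef dfx); rewrite -derive1E.
Qed.

Lemma is_derive_derive1 f g : (forall x, is_derive x 1 f (g x)) -> derive1 f = g.
Proof. by move=> fg; apply/funext => x; rewrite derive1E; apply: derive_val. Qed.

Lemma smooth1_derive1 f : smooth1 f -> smooth1 (derive1 f).
Proof. by move=> sf k; have [g /is_derive_derive1 -> ] := sf k.+1. Qed.

Lemma smooth1_primitive f g : (forall x, is_derive x 1 f (g x)) -> smooth1 g ->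
  smooth1 f.
Proof. by move=> fg sg [|k] //; exists g. Qed.

Lemma is_derive_continuous f (g : R -> R) :
  (forall x, is_derive x 1 f (g x)) -> continuous f.
Proof.
move=> fg x; apply/differentiable_continuous/derivable1_diffP.
by have [] := fg x.
Qed.

Lemma smooth1_continuous f : smooth1 f -> continuous f.
Proof. by move=> /smooth1_is_derive/is_derive_continuous. Qed.

(** The functions x^-k exp(-1/x), extended by 0, are smooth because their
    derivatives are combinations of functions of the same form. *)
Definition flat (k : nat) x : R :=
  if 0 < x then x ^- k * expR (- x^-1) else 0.

(** From exp y = (exp (y / m)) ^ m >= (y / m) ^ m with m = k + 2 and y = 1 / x.
    The factor x ^ 2 makes the difference quotient at 0 tend to 0. *)
Lemma flat_le k x : 0 < x -> flat k x <= k.+2%:R ^+ k.+2 * x ^+ 2.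
Proof.
move=> x0; rewrite /flat x0.
have e1 : 0 < (k.+2%:R * x)^-1 :> R by rewrite invr_gt0 mulr_gt0.
have e2 : (k.+2%:R * x) ^- k.+2 <= expR (x^-1).
  have -> : x^-1 = (k.+2%:R * x)^-1 * k.+2%:R.
    by rewrite invfM mulrAC mulVf ?mul1r// pnatr_eq0.
  rewrite expRM_natr -exprVn; apply: lerXn2r; rewrite ?nnegrE ?expR_ge0 ?ltW//.
  by apply: lt_le_trans (expR_ge1Dx _); rewrite ltrDr.
rewrite expRN -(ler_pM2l (exprn_gt0 k x0)) mulrA divff ?mul1r; last first.
  by rewrite expf_neq0 // gt_eqF.
rewrite -[leRHS]invrK lef_pV2 ?posrE ?expR_gt0 ?invr_gt0 //; last first.
  by rewrite mulr_gt0 ?exprn_gt0// mulr_gt0 ?exprn_gt0.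
apply: le_trans e2; rewrite le_eqVlt; apply/orP; left; apply/eqP.
by congr (_ ^-1); rewrite exprMn mulrCA -exprD addn2.
Qed.

Lemma flat_ge0 k x : 0 <= flat k x.
Proof.
by rewrite /flat; case: ifP => // x0; rewrite mulr_ge0 ?expR_ge0// invr_ge0 exprn_ge0 ?ltW.
Qed.

Lemma is_derive_flat k x :
  is_derive x 1 (flat k) (flat k.+2 x - k%:R * flat k.+1 x).
Proof.
have [x0|x0|->] := ltrgt0P x.
- have -> : flat k.+2 x - k%:R * flat k.+1 x =
    x ^- k * (expR (- x^-1) * (x ^- 2)) + expR (- x^-1) * (- k%:R * x ^- k.+1).
    rewrite /flat x0 -(addn2 k) exprD invfM; ring.
  apply: (@near_eq_is_derive _ _ _ (fun x => x ^- k * expR (- x^-1))).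
    by near=> y; rewrite /flat ifT //; near: y; exact: lt_nbhsr.
  have xn0 : x != 0 by rewrite gt_eqF.
  have dV : is_derive x 1 (fun y : R => y^-1) (- x ^- 2).
    by have := @is_deriveV R id x 1 1 xn0 (is_derive_id _ _); rewrite /GRing.scale /= mulr1.
  have dVN : is_derive x 1 (fun y : R => - y^-1) (x ^- 2).
    by rewrite -[x ^- 2]opprK; exact: is_deriveN.
  have dE := @is_derive1_comp R expR (fun y => - y^-1) x _ _ (is_derive_expR _) dVN.
  have dX : is_derive x 1 (fun y : R => y ^- k) (- k%:R * x ^- k.+1).
    have -> : (fun y : R => y ^- k) = (fun y : R => y^-1) ^+ k.
      by apply/funext => y; rewrite -exprVn fctE.
    apply: is_derive_eq; rewrite /GRing.scale /=.
    case: k => [|k]; first by rewrite !mul0r oppr0 mul0r.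
    by rewrite [k.+1.-1]/= -exprVn mulrN !mulNr -mulrA -exprVn -exprD addn2 exprVn.
  exact: is_deriveM.
- rewrite /flat !ltNge (ltW x0) /= mulr0 subr0.
  apply: (@near_eq_is_derive _ _ _ (cst 0)).
  near=> y; rewrite ifF //; apply/negP/negP; rewrite -leNgt ltW //.
  by near: y; exact: lt_nbhsl.
- have f0 l : flat l 0 = 0 by rewrite /flat ltxx.
  rewrite !f0 mulr0 subr0.
  suff cv : (fun h : R => h^-1 *: (flat k (h *: 1 + 0) - flat k 0)) @ 0^' --> (0 : R).
    by apply: DeriveDef; [apply/cvg_ex; exists 0|apply: cvg_lim].
  set M : R := k.+2%:R ^+ k.+2.
  have M0 : 0 <= M by rewrite exprn_ge0.
  have B (h : R) : h != 0 -> `|h^-1 *: (flat k (h *: 1 + 0) - flat k 0)| <= M * `|h|.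
    move=> hn0; rewrite f0 subr0 addr0 /GRing.scale /= mulr1 normrM.
    have [h0|h0] := ltP 0 h; last first.
      by rewrite /flat ltNge h0 /= normr0 mulr0 mulr_ge0.
    rewrite (ger0_norm (flat_ge0 k h)) !gtr0_norm ?invr_gt0//.
    by rewrite mulrC ler_pdivrMr// -mulrA -expr2; exact: flat_le.
  apply/cvgrPdist_lt => e e0.
  have d0 : 0 < e / (M + 1) by rewrite divr_gt0// ltr_wpDl.
  near=> h.
  rewrite sub0r normrN; apply: le_lt_trans (B h _) _; first by near: h; exact: nbhs_dnbhs_neq.
  apply: (@le_lt_trans _ _ ((M + 1) * `|h|)); first by rewrite ler_wpM2r// lerDl.
  rewrite -ltr_pdivlMl ?ltr_wpDl// mulrC.
  by near: h; exact: dnbhs0_lt.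
Unshelve. all: by end_near. Qed.

Lemma flat_smooth k : smooth1 (flat k).
Proof.
move=> m; elim: m k => // m ih k; eexists; first exact: is_derive_flat.
apply: CkD; first exact: ih.
under eq_fun do rewrite -mulNr.
by apply: CkM; [exact: Ck_cst|exact: ih].
Qed.

Definition bumpf a b x : R := flat 0 (x - a) * flat 0 (b - x).

Lemma bump_smooth a b : smooth1 (bumpf a b).
Proof.
apply: smooth1M.
  by under eq_fun do rewrite -[_ - a]/(_ + - a) -[X in X - a]mul1r; exact: smooth1_affine (flat_smooth 0).
by under eq_fun do rewrite addrC -mulN1r; exact: smooth1_affine (flat_smooth 0).
Qed.

Lemma bump_ge0 a b x : 0 <= bumpf a b x.
Proof. by rewrite mulr_ge0 ?flat_ge0. Qed.

Lemma bump_gt0 a b x : a < x < b -> 0 < bumpf a b x.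
Proof.
move=> /andP[ax xb]; rewrite /bumpf /flat !subr_gt0 ax xb !expr0 !invr1 !mul1r.
by rewrite mulr_gt0 ?expR_gt0.
Qed.

(** With a closed interval the condition passes to the derivative by
    locality. *)
Definition vanishes_off a b f := forall x, ~~ (a <= x <= b) -> f x = 0.

Lemma bump_off a b : vanishes_off a b (bumpf a b).
Proof.
move=> x; rewrite /bumpf /flat !subr_gt0.
case: (ltP a x) => [ax|]; last by rewrite mul0r.
by case: (ltP x b) => [xb|]; rewrite ?mulr0// (ltW ax) (ltW xb).
Qed.

Lemma derive1_off a b f : vanishes_off a b f -> vanishes_off a b (derive1 f).
Proof.
move=> f0 x xab; rewrite derive1E.
rewrite (@near_eq_derive _ _ _ f (cst 0)) ?derive_cst//.
move: xab; rewrite negb_and -!ltNge => /orP[xa|bx].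
  near=> y; apply: f0; rewrite negb_and -!ltNge; apply/orP; left.
  by near: y; exact: lt_nbhsl.
near=> y; apply: f0; rewrite negb_and -!ltNge; apply/orP; right.
by near: y; exact: lt_nbhsr.
Unshelve. all: by end_near. Qed.

Lemma continuous_left_cst f a c : continuous f ->
  (forall x, x < a -> f x = c) -> f a = c.
Proof.
move=> cf fc; apply: (@cvg_unique _ (@Rhausdorff R) (f @ a^'-)).
  exact: cvg_at_left_filter (cf a).
by apply: cvg_near_cst; near=> x; apply/fc.
Unshelve. all: by end_near. Qed.

Lemma continuous_right_cst f a c : continuous f ->
  (forall x, a < x -> f x = c) -> f a = c.
Proof.
move=> cf fc; apply: (@cvg_unique _ (@Rhausdorff R) (f @ a^'+)).
  exact: cvg_at_right_filter (cf a).
by apply: cvg_near_cst; near=> x; apply/fc.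
Unshelve. all: by end_near. Qed.

Lemma exists_primitive a b f : a <= b -> continuous f -> vanishes_off a b f ->
  exists F, [/\ forall x, is_derive x 1 F (f x),
    forall x, x <= a -> F x = 0 & forall x, b <= x -> F x = F b].
Proof.
move=> ab cf f0.
have intf c d : (@lebesgue_measure R).-integrable `[c, d] (EFin \o f).
  apply: continuous_compact_integrable; first exact: segment_compact.
  exact/continuous_subspaceT.
(* Starting at a - 1 puts a in the range of the fundamental theorem of
   calculus; to the left of a the integral vanishes identically. *)
pose F x : R := (\int[lebesgue_measure]_(t in `[a - 1, x]) f t)%R.
have F0 x : x < a -> F x = 0.
  move=> xa; rewrite /F /Rintegral integral0_eq// => t /=.
  rewrite in_itv /= => /andP[_ tx]; congr (_%:E); apply: f0.
  by rewrite negb_and -ltNge (le_lt_trans tx xa).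
have dF x : is_derive x 1 F (f x).
  have [xa|ax] := ltP x a.
    rewrite f0; last by rewrite negb_and -ltNge xa.
    apply: (@near_eq_is_derive _ _ _ (cst 0)).
    by near=> y; rewrite F0 //; near: y; exact: lt_nbhsl.
  have [] := @continuous_FTC1_closed R f (a - 1) x (x + 1) _ (intf _ _) _ (cf x).
  - by rewrite ltrDl.
  - by rewrite (lt_le_trans _ ax)// gtrDl ltrN10.
  by move=> dFx e; apply: (DeriveDef dFx); rewrite -derive1E.
have cF := is_derive_continuous dF.
exists F; split => // x.
  rewrite le_eqVlt => /predU1P[->|/F0//].
  exact: continuous_left_cst.
move=> bx; have [c] := @MVT_segment R F f b x bx (fun y _ => dF y) (continuous_subspaceT cF).
rewrite in_itv /= => /andP[bc cx].
suff -> : f c = 0 by rewrite mul0r => /eqP; rewrite subr_eq0 => /eqP.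
move: bc; rewrite le_eqVlt => /predU1P[<-|bc].
  by apply: continuous_right_cst => // y by_; apply: f0; rewrite negb_and -!ltNge by_ orbT.
by apply: f0; rewrite negb_and -!ltNge bc orbT.
Unshelve. all: by end_near. Qed.

Lemma bump_mass_gt0 a b F : a < b -> (forall x, is_derive x 1 F (bumpf a b x)) ->
  F a < F b.
Proof.
move=> ab dF; have cF := is_derive_continuous dF.
have [c] := @MVT R F (bumpf a b) a b ab (fun y _ => dF y) (continuous_subspaceT cF).
by rewrite in_itv /= => cab /eqP; rewrite -subr_gt0 => /eqP ->; rewrite mulr_gt0 ?bump_gt0 ?subr_gt0.
Qed.

(** Subtracting the multiple of the bump with the same total mass leaves a
    function of mass zero, whose primitive is again supported in [a, b]. *)
Lemma smooth1_mod_derive a b f : a < b -> smooth1 f -> vanishes_off a b f ->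
  exists c g, [/\ smooth1 g, vanishes_off a b g &
    forall x, f x = c * bumpf a b x + derive1 g x].
Proof.
move=> ab sf f0.
have [F [dF Fa Fb]] := exists_primitive (ltW ab) (smooth1_continuous sf) f0.
have [B [dB Ba Bb]] := exists_primitive (ltW ab) (smooth1_continuous (bump_smooth a b)) (@bump_off a b).
have Bgt0 : 0 < B b by rewrite -(Ba a (lexx _)) bump_mass_gt0.
pose c := F b / B b; pose g x := F x - c * B x.
have dg x : is_derive x 1 g (f x - c * bumpf a b x).
  by have -> : g = F - (c \*: B); [apply/funext|exact: is_deriveB].
exists c, g; split.
- apply: (smooth1_primitive dg); apply: smooth1D => //.
  under eq_fun do rewrite -mulNr.
  by apply: smooth1M; [exact: smooth1_cst|exact: bump_smooth].
- move=> x; rewrite negb_and -!ltNge /g => /orP[xa|bx].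
    by rewrite Fa ?Ba ?ltW// mulr0 subr0.
  by rewrite Fb ?Bb ?ltW// /c divfK ?subrr// gt_eqF.
- by move=> x; rewrite (is_derive_derive1 dg) addrC subrK.
Qed.

(** The step is the normalised primitive of a bump. *)
Lemma exists_smooth_step : exists s : R -> R, [/\ smooth1 s,
  forall x, 0 <= s x <= 1, forall x, x <= 0 -> s x = 0 &
  forall x, 1 <= x -> s x = 1].
Proof.
have [B [dB B0 B1]] := exists_primitive ler01 (smooth1_continuous (bump_smooth 0 1)) (@bump_off 0 1).
have Bgt0 : 0 < B 1 by rewrite -(B0 0 (lexx _)) bump_mass_gt0 ?ltr01.
have mono x y : x <= y -> B x <= B y.
  move=> xy; have [c _] := @MVT_segment R B (bumpf 0 1) x y xy
    (fun z _ => dB z) (continuous_subspaceT (is_derive_continuous dB)).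
  by move=> e; rewrite -subr_ge0 e mulr_ge0 ?bump_ge0 ?subr_ge0.
exists (fun x => B x * (B 1)^-1); split.
- apply: smooth1M; last exact: smooth1_cst.
  exact: smooth1_primitive dB (bump_smooth _ _).
- move=> x; rewrite divr_ge0 ?(ltW Bgt0)//=; last first.
    have [x0|/ltW x0] := leP x 0; first by rewrite B0.
    by rewrite -[leLHS](B0 0 (lexx _)); exact: mono.
  rewrite ler_pdivrMr// mul1r; have [x1|/ltW x1] := leP x 1; first exact: mono.
  by rewrite B1.
- by move=> x x0; rewrite B0 ?mul0r.
- by move=> x x1; rewrite B1 ?divff ?gt_eqF.
Qed.

(** The product of a step rising at a and a step falling at b, both
    compressed by the factor k, is eventually 1 at each point of the open
    interval. *)
Lemma exists_smooth_indic a b : exists r : nat -> R -> R, [/\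
  forall k, smooth1 (r k), forall k, vanishes_off a b (r k),
  forall k x, 0 <= r k x <= 1 &
  forall x, (r ^~ x) @ \oo --> (\1_(`]a, b[%classic) x : R)].
Proof.
have [s [ss s01 s0 s1]] := exists_smooth_step.
exists (fun k x => s (k%:R * (x - a)) * s (k%:R * (b - x))).
have z k x : ~~ (a < x < b) -> s (k%:R * (x - a)) * s (k%:R * (b - x)) = 0.
  rewrite negb_and -!leNgt => /orP[xa|bx]; [rewrite s0 ?mul0r//|rewrite mulrC s0 ?mul0r//];
  by rewrite mulr_ge0_le0 // subr_le0.
split.
- move=> k; apply: smooth1M.
    by under eq_fun do rewrite mulrBr; exact: smooth1_affine.
  by under eq_fun do rewrite mulrBr addrC -mulNr; exact: smooth1_affine.
- move=> k x xab; apply: z; apply: contra xab => /andP[/ltW-> /ltW->] //.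
- move=> k x; have /andP[? ?] := s01 (k%:R * (x - a)); have /andP[? ?] := s01 (k%:R * (b - x)).
  by rewrite mulr_ge0//= mulr_ile1.
- move=> x; rewrite indicE; case: (boolP (x \in _)) => [|].
    rewrite inE /= in_itv /= => /andP[ax xb]; apply: cvg_near_cst.
    near=> k; rewrite !s1 ?mulr1//; rewrite -ler_pdivrMr ?subr_gt0//; near: k; exact: nbhs_infty_ger.
  rewrite notin_setE /= in_itv /= => /negP xab; apply: cvg_near_cst.
  by near=> k; rewrite z.
Unshelve. all: by end_near. Qed.

End smooth1.

(** * Partial derivatives and integration by parts *)

Section partials.
Context {R : realType}.

(** Both sides have the same difference quotients, which reduces partial
    derivatives to calculus in one variable. *)
Lemma is_derive_lineE n (f : 'rV[R]_n -> R) (v y : 'rV[R]_n) (t d : R) :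
  is_derive (t *: v + y) v f d <-> is_derive t 1 (fun h => f (h *: v + y)) d.
Proof.
have E : (fun h : R => h^-1 *: ((f \o shift (t *: v + y)) (h *: v) - f (t *: v + y)))
       = (fun h : R => h^-1 *: (((fun s => f (s *: v + y)) \o shift t) (h *: (1 : R)) -
            f (t *: v + y))).
  apply/funext => h /=; congr (_ *: (f _ - _)).
  by rewrite addrA -scalerDl /GRing.scale /= mulr1.
by split=> -[df <-]; split; rewrite /derivable /derive /= in df *; rewrite ?E// -?E// in df *.
Qed.

Lemma is_derive_line0 n (f : 'rV[R]_n -> R) (v y : 'rV[R]_n) (d : R) :
  is_derive (0 : R) 1 (fun h => f (h *: v + y)) d -> is_derive y v f d.
Proof. by move=> /is_derive_lineE; rewrite scale0r add0r. Qed.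

Lemma partialE n (i : 'I_n) (f g : 'rV[R]_n -> R) :
  (forall x, is_derive x (delta_mx ord0 i) f (g x)) -> partial i f = g.
Proof. by move=> fg; apply/funext => x; apply: derive_val. Qed.

Lemma is_derive_partial n (i : 'I_n) (f : 'rV[R]_n -> R) :
  (forall x, derivable f x (delta_mx ord0 i)) ->
  forall x, is_derive x (delta_mx ord0 i) f (partial i f x).
Proof. by move=> df x; exact: DeriveDef. Qed.

(** * Tensor products of functions of one variable *)

Definition tensor n (r : 'I_n -> R -> R) (x : 'rV[R]_n) : R :=
  \prod_j r j (x ord0 j).

Definition upd n (r : 'I_n -> R -> R) i f : 'I_n -> R -> R :=
  fun j => if j == i then f else r j.

Lemma tensor_upd n (r : 'I_n -> R -> R) i f x :
  tensor (upd r i f) x = f (x ord0 i) * \prod_(j | j != i) r j (x ord0 j).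
Proof.
rewrite /tensor (bigD1 i)//= /upd eqxx; congr (_ * _).
by apply: eq_bigr => j /negbTE ->.
Qed.

Lemma tensor_bigD1 n (r : 'I_n -> R -> R) i x :
  tensor r x = r i (x ord0 i) * \prod_(j | j != i) r j (x ord0 j).
Proof. by rewrite /tensor (bigD1 i). Qed.

Lemma is_derive_tensor n (r : 'I_n -> R -> R) i (f : R -> R) x :
  (forall t : R, is_derive t 1 (r i) (f t)) ->
  is_derive x (delta_mx ord0 i) (tensor r) (tensor (upd r i f) x).
Proof.
move=> rf; apply: is_derive_line0.
set c := \prod_(j | j != i) r j (x ord0 j).
rewrite (_ : (fun h => _) = c \*: (r i \o (fun h => h + x ord0 i))); last first.
  apply/funext => h; rewrite (tensor_bigD1 _ i) !mxE !eqxx /= mulr1 /c.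
  rewrite /GRing.scale /= mulrC; congr (_ * _); apply: eq_bigr => j /negbTE ji.
  by rewrite !mxE ji !eqxx /= mulr0 add0r.
have d1 : is_derive (0 : R) 1 (fun h : R => h + x ord0 i) 1.
  rewrite (_ : (fun h : R => _) = id + cst (x ord0 i)) //.
  by apply: is_derive_eq; rewrite addr0.
rewrite tensor_upd mulrC -/c.
have := @is_derive1_comp _ (r i) (fun h => h + x ord0 i) 0 (f (x ord0 i)) 1.
by rewrite add0r mulr1 => /(_ (rf _) d1) ?; exact: is_deriveZ.
Qed.

Lemma continuous_prod_fun (T : topologicalType) (I : Type) (s : seq I) (P : pred I)
    (f : I -> T -> R) : (forall i, continuous (f i)) ->
  continuous (fun x => \prod_(i <- s | P i) f i x).
Proof.
move=> cf; elim: s => [|i s ih].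
  by under eq_fun do rewrite big_nil; move=> x; exact: cvg_cst.
under eq_fun do rewrite big_cons; case: (P i) => // x.
by apply: cvgM; [exact: cf|exact: ih].
Qed.

Lemma continuous_mulD (T : topologicalType) (f g h k : T -> R) :
  continuous f -> continuous g -> continuous h -> continuous k ->
  continuous (fun x => f x * g x + h x * k x).
Proof.
move=> cf cg ch ck x.
by apply: cvgD; apply: cvgM; [exact: cf|exact: cg|exact: ch|exact: ck].
Qed.

Lemma tensor_continuous n (r : 'I_n -> R -> R) : (forall j, continuous (r j)) ->
  continuous (tensor r).
Proof.
move=> cr; apply: continuous_prod_fun => j x.
by apply: continuous_comp; [exact: coord_continuous|exact: cr].
Qed.

(** A partial derivative of a tensor is a tensor in which one factor has been
    differentiated, so the iterated ones never leave the class. *)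
Lemma tensor_smooth n (r : 'I_n -> R -> R) : (forall j, smooth1 (r j)) ->
  smooth (tensor r).
Proof.
move=> sr s g.
have [r' [sr' ->]] : exists r', (forall j, smooth1 (r' j)) /\ g = tensor r'.
  rewrite {}/g; elim: s => [|i s [r' [sr' IH]]]; first by exists r.
  exists (upd r' i (derive1 (r' i))); split.
    move=> j; rewrite /upd; case: eqP => _; last exact: sr'.
    exact: smooth1_derive1.
  rewrite /= IH; apply: partialE => x.
  by apply: is_derive_tensor => t; exact: smooth1_is_derive.
split; first by apply: tensor_continuous => j; exact: smooth1_continuous.
move=> i x; have := @is_derive_tensor n r' i (derive1 (r' i)) x.
by move=> /(_ (smooth1_is_derive (sr' i)))[].
Qed.

Lemma tensor_eq0 n (r : 'I_n -> R -> R) j (x : 'rV[R]_n) : r j (x ord0 j) = 0 -> tensor r x = 0.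
Proof. by move=> rj; rewrite (tensor_bigD1 r j) rj mul0r. Qed.

Lemma tensor_off n (r : 'I_n -> R -> R) (a b : 'I_n -> R) x :
  (forall j, vanishes_off (a j) (b j) (r j)) -> ~ cbox a b x -> tensor r x = 0.
Proof.
move=> r0; apply: contra_notP => tx; apply/cboxE => j; apply: contrapT => /negP xj.
by apply: tx; apply: (@tensor_eq0 _ _ j); exact: r0.
Qed.

Lemma test_fun_sub_cbox n (Omega : set 'rV[R]_n) f (a b : 'I_n -> R) :
  smooth f -> (forall x, ~ cbox a b x -> f x = 0) -> cbox a b `<=` Omega ->
  test_fun Omega f.
Proof.
move=> sf f0 abO.
have cl : closed (cbox a b).
  apply: compact_closed; [exact: norm_hausdorff|exact: compact_cbox].
have sub : closure [set x | f x != 0] `<=` cbox a b.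
  rewrite (closure_id (cbox a b)).1//; apply: closureS => x /= /eqP fx.
  by apply: contrapT => /f0.
split => //; last exact: subset_trans sub abO.
exact: (subclosed_compact (@closed_closure _ _) (@compact_cbox R n a b) sub).
Qed.

Lemma test_fun_tensor n (Omega : set 'rV[R]_n) (r : 'I_n -> R -> R) (a b : 'I_n -> R) :
  (forall j, smooth1 (r j)) -> (forall j, vanishes_off (a j) (b j) (r j)) ->
  cbox a b `<=` Omega -> test_fun Omega (tensor r).
Proof.
move=> sr r0; apply: test_fun_sub_cbox; first exact: tensor_smooth.
by move=> x; exact: tensor_off.
Qed.

(** * The integral of a partial derivative *)

Lemma continuous_rV (T : topologicalType) n (F : T -> 'rV[R]_n) :
  (forall i, continuous (fun z => F z ord0 i)) -> continuous F.
Proof.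
move=> cF z; apply/cvgrPdist_lt => e e0.
have : \forall y \near z, forall i, `|F z ord0 i - F y ord0 i| < e.
  by apply: filter_forall => i; move/cvgrPdist_lt : (cF i z); exact.
apply: filterS => y h.
rewrite /Num.norm /= mx_normrE; apply/bigmax_ltP; split => //= -[k i] _ /=.
by rewrite ord1 !mxE.
Qed.

Lemma continuous_rV_cons n (t : R) :
  continuous (fun y : 'rV[R]_n => rV_cons (t, y)).
Proof.
apply: continuous_rV => i; case: (unliftP ord0 i) => [j|] ->.
  by under eq_fun do rewrite rV_consS; exact: coord_continuous.
by under eq_fun do rewrite rV_cons0; exact: cst_continuous.
Qed.

Lemma rV_cons_line0 n (h t : R) (y : 'rV[R]_n) :
  h *: delta_mx ord0 ord0 + rV_cons (t, y) = rV_cons (h + t, y).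
Proof.
apply/rowP => i; rewrite [LHS]mxE [X in X + _]mxE [X in _ * X]mxE.
case: (unliftP ord0 i) => [j|] ->.
  by rewrite !rV_consS /= mulr0 add0r.
by rewrite !rV_cons0 /= mulr1.
Qed.

Lemma rV_cons_lineS n (h t : R) (y : 'rV[R]_n) j :
  h *: delta_mx ord0 (lift ord0 j) + rV_cons (t, y) =
  rV_cons (t, h *: delta_mx ord0 j + y).
Proof.
apply/rowP => i; rewrite [LHS]mxE [X in X + _]mxE [X in _ * X]mxE.
case: (unliftP ord0 i) => [k|] ->.
  by rewrite !rV_consS !mxE (inj_eq lift_inj).
by rewrite !rV_cons0 /= mulr0 add0r.
Qed.

Lemma integral_derive0 (M : R) (f f' : R -> R) : 0 < M ->
  (forall t : R, is_derive t 1 f (f' t)) -> continuous f' ->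
  vanishes_off (- M) M f -> vanishes_off (- M) M f' ->
  (\int[lebesgue_measure]_t (f' t)%:E = 0)%E.
Proof.
move=> M0 df cf' f0 f'0; have cf := is_derive_continuous df.
have M1 : - (M + 1) < M + 1 by lra.
have out c : M < `|c| -> ~~ (- M <= c <= M) by rewrite -ler_norml -ltNge.
have := @continuous_FTC2 R f' f (- (M + 1)) (M + 1) M1.
rewrite !f0; last 2 first.
- by apply: out; rewrite normrN gtr0_norm; lra.
- by apply: out; rewrite gtr0_norm; lra.
rewrite subee// => FTC.
transitivity (\int[lebesgue_measure]_(t in `[(- (M + 1))%R, (M + 1)%R]) (f' t)%:E)%E.
  rewrite [RHS]integral_mkcond; apply: eq_integral => t _.
  rewrite patchE; case: ifPn => //; rewrite notin_setE /= in_itv /= => /negP tM.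
  rewrite f'0//; apply: contra tM; lra.
apply: FTC.
- exact: continuous_subspaceT.
- split; [by move=> x _; have [] := df x|..].
    exact: cvg_at_right_filter (cf _).
  exact: cvg_at_left_filter (cf _).
- by move=> x _; rewrite (is_derive_derive1 df).
Qed.

Lemma continuous_cbox_integrable n (f : 'rV[R]_n -> R) (a b : 'I_n -> R) :
  continuous f -> (forall x, ~ cbox a b x -> f x = 0) ->
  (exists M, forall x, `|f x| <= M) /\
  (lebesgue_rV R n).-integrable setT (EFin \o f).
Proof.
move=> cf f0.
have [M HM] : exists M, forall x, `|f x| <= M.
  have : compact (f @` cbox a b).
    by apply: continuous_compact; [exact: continuous_subspaceT|exact: compact_cbox].
  move=> /compact_bounded[M [_ HM]]; exists (Num.max 0 (M + 1)) => x.
  have [xab|xab] := pselect (cbox a b x); last by rewrite f0// normr0 le_max lexx.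
  rewrite le_max; apply/orP; right; apply: HM; [by rewrite ltrDl|by exists x].
split; first by exists M.
rewrite (_ : EFin \o f = (EFin \o f) \_ (cbox a b)); last first.
  apply/funext => x; rewrite patchE; case: ifPn => //.
  by rewrite notin_setE /= => /f0 ->.
rewrite -integrable_mkcond; last exact: measurable_cbox.
apply: measurable_bounded_integrable; first exact: measurable_cbox.
- exact: lebesgue_rV_cbox_lty.
- by apply: measurable_funTS; exact: continuous_measurable_rV.
- by exists M; split; [exact: num_real|move=> k Mk x _; exact: le_trans (HM x) (ltW Mk)].
Qed.

(** Induction along the construction of the measure: Fubini isolates the
    coordinate of differentiation, where the fundamental theorem of calculus
    applies. *)
Lemma integral_partial n (i : 'I_n) (M : R) (g g' : 'rV[R]_n -> R) : 0 < M ->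
  (forall x, is_derive x (delta_mx ord0 i) g (g' x)) -> continuous g' ->
  (forall x, ~ cbox (fun=> - M) (fun=> M) x -> g x = 0) ->
  (forall x, ~ cbox (fun=> - M) (fun=> M) x -> g' x = 0) ->
  (\int[lebesgue_rV R n]_x (g' x)%:E = 0)%E.
Proof.
move=> M0; elim: n i g g' => [[]//|n ih] i g g' dg cg' g0 g'0.
have [B ig'] := continuous_cbox_integrable cg' g'0.
have mg' : measurable_fun setT (EFin \o g').
  by apply/measurable_EFinP; exact: continuous_measurable_rV.
have iprod : (lebesgue_measure \x lebesgue_rV R n)%E.-integrable setT
    ((EFin \o g') \o @rV_cons R n).
  apply/integrableP; split.
    by apply: measurableT_comp => //; exact: measurable_rV_cons.
  have /integrableP[_] := ig'.
  rewrite /= /lebesgue_rV_cons ge0_integral_pushforward ?preimage_setT//.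
  - exact: measurable_rV_cons.
  - by apply/measurable_EFinP; apply: measurableT_comp => //; exact: continuous_measurable_rV.
have /= -> := integral_pushforward (@measurable_rV_cons R n) mg' iprod measurableT.
rewrite preimage_setT.
have cboxS t y : cbox (fun=> - M) (fun=> M) (rV_cons (t, y)) <->
    - M <= t <= M /\ cbox (fun=> - M) (fun=> M) y.
  split=> [/cboxE h|[tM /cboxE h]].
    split; first by have := h ord0; rewrite rV_cons0.
    by apply/cboxE => j; have := h (lift ord0 j); rewrite rV_consS.
  apply/cboxE => j; case: (unliftP ord0 j) => [k|] ->; first by rewrite rV_consS.
  by rewrite rV_cons0.
case: (unliftP ord0 i) => [j|] ei; rewrite {}ei in dg.
- rewrite -integral12_prod_meas1//; apply: integral0_eq => t _.
  rewrite /fubini_F /=; apply: (ih j (fun y => g (rV_cons (t, y)))).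
  + move=> y; apply: is_derive_line0.
    under eq_fun do rewrite -rV_cons_lineS.
    by apply/is_derive_lineE; rewrite scale0r add0r; exact: dg.
  + by move=> y; apply: continuous_comp; [exact: continuous_rV_cons|exact: cg'].
  + by move=> y yM; apply: g0 => /cboxS[].
  + by move=> y yM; apply: g'0 => /cboxS[].
- rewrite -integral21_prod_meas1//; apply: integral0_eq => y _.
  rewrite /fubini_G /=; apply: (@integral_derive0 M (fun t => g (rV_cons (t, y)))) => //.
  + move=> t.
    under eq_fun do rewrite -[X in rV_cons (X, _)]addr0 -rV_cons_line0.
    by apply/is_derive_lineE; rewrite rV_cons_line0 addr0; exact: dg.
  + move=> t; apply: (@continuous_comp _ _ _ (fun t => rV_cons (t, y))); last exact: cg'.
    move: t; apply: continuous_rV => j; case: (unliftP ord0 j) => [k|] ->.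
      by under eq_fun do rewrite rV_consS; exact: cst_continuous.
    by under eq_fun do rewrite rV_cons0; move=> t.
  + by move=> t tM; apply: g0 => /cboxS[h _]; rewrite h in tM.
  + by move=> t tM; apply: g'0 => /cboxS[h _]; rewrite h in tM.
Qed.

End partials.

(** * The fundamental lemma of the calculus of variations *)

Section fundamental_lemma.
Context {R : realType} {n : nat}.
Local Notation mu := (lebesgue_rV R n).
Implicit Types (r : 'I_n -> R -> R) (p q : 'I_n -> R) (f g w : 'rV[R]_n -> R).

Definition test_family p q r :=
  forall j, smooth1 (r j) /\ vanishes_off (p j) (q j) (r j).

Lemma test_family_upd p q r i (f : R -> R) : test_family p q r ->
  smooth1 f -> vanishes_off (p i) (q i) f -> test_family p q (upd r i f).
Proof. by move=> tr sf f0 j; rewrite /upd; case: eqP => [->|]. Qed.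

Lemma vanishes_off_open (a b : R) (f : R -> R) x : continuous f ->
  vanishes_off a b f -> ~~ (a < x < b) -> f x = 0.
Proof.
move=> cf f0; rewrite negb_and -!leNgt => /orP[].
  rewrite le_eqVlt => /predU1P[->|xa].
    by apply: continuous_left_cst => // y ya; apply: f0; rewrite negb_and -!ltNge ya.
  by apply: f0; rewrite negb_and -!ltNge xa.
rewrite le_eqVlt => /predU1P[<-|bx].
  by apply: continuous_right_cst => // y yb; apply: f0; rewrite negb_and -!ltNge yb orbT.
by apply: f0; rewrite negb_and -!ltNge bx orbT.
Qed.

Lemma tensor_off_obox p q r x : test_family p q r -> ~ obox p q x -> tensor r x = 0.
Proof.
move=> tr; apply: contra_notP => tx; apply/oboxE => j; apply: contrapT => /negP xj.
apply: tx; apply: (@tensor_eq0 _ _ _ j).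
exact: vanishes_off_open (smooth1_continuous (tr j).1) (tr j).2 xj.
Qed.

Lemma tensor_family_continuous p q r : test_family p q r -> continuous (tensor r).
Proof. by move=> tr; apply: tensor_continuous => j; exact: smooth1_continuous (tr j).1. Qed.

Lemma tensor_family_bounded p q r : test_family p q r ->
  exists M, forall x, `|tensor r x| <= M.
Proof.
move=> tr; have [] // := @continuous_cbox_integrable R n (tensor r) p q.
  exact: tensor_family_continuous tr.
by move=> x; apply: tensor_off => j; exact: (tr j).2.
Qed.

Lemma integrable_mul_bounded (D : set 'rV[R]_n) f g : measurable D ->
  mu.-integrable D (EFin \o f) -> measurable_fun D g ->
  (exists M, forall x, `|g x| <= M) ->
  mu.-integrable D (EFin \o (fun x => f x * g x)).
Proof.
move=> mD fi mg [M gM].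
rewrite (_ : EFin \o _ = ((EFin \o f) \* (EFin \o g))%E)//.
apply: integrableMl => //; exists M; split; first exact: num_real.
by move=> k Mk x _; exact: le_trans (gM x) (ltW Mk).
Qed.

Lemma integrable_tensor (D : set 'rV[R]_n) f p q r : measurable D ->
  mu.-integrable D (EFin \o f) -> test_family p q r ->
  mu.-integrable D (EFin \o (fun x => f x * tensor r x)).
Proof.
move=> mD fi tr; apply: integrable_mul_bounded => //.
  by apply: measurable_funTS; apply: continuous_measurable_rV; exact: tensor_family_continuous tr.
exact: tensor_family_bounded tr.
Qed.

(** Tensors of smooth approximations of indicators of intervals converge,
    dominated by 1, to the indicator of a box. *)
Lemma integral_obox_eq0 p q g :
  mu.-integrable (obox p q) (EFin \o g) ->
  (forall r, test_family p q r ->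
    (\int[mu]_(x in obox p q) (g x * tensor r x)%:E = 0)%E) ->
  forall a b : 'I_n -> R,
    (\int[mu]_(x in obox a b `&` obox p q) (g x)%:E = 0)%E.
Proof.
move=> gi g0 a b; pose D := obox p q; have mD : measurable D by exact: measurable_obox.
pose a' j := Num.max (a j) (p j); pose b' j := Num.min (b j) (q j).
have abE : obox a b `&` D = D `&` obox a' b' by rewrite -oboxI setICA setIid.
have /choice[rr hrr] : forall j, exists rj : nat -> R -> R, [/\
  forall k, smooth1 (rj k), forall k, vanishes_off (a' j) (b' j) (rj k),
  forall k x, 0 <= rj k x <= 1 &
  forall x, (rj ^~ x) @ \oo --> (\1_(`]a' j, b' j[%classic) x : R)].
  by move=> j; exact: exists_smooth_indic.
pose r k j := rr j k.
have tr k : test_family p q (r k).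
  move=> j; have [sr r0 _ _] := hrr j; split; first exact: sr.
  move=> x xpq; apply: r0; apply: contra xpq.
  by rewrite ge_max le_min => /andP[/andP[_ ->] /andP[_ ->]].
have cvr x : (fun k => tensor (r k) x) @ \oo --> (\1_(obox a' b') x : R).
  have -> : \1_(obox a' b') x = \prod_j \1_(`]a' j, b' j[%classic) (x ord0 j) :> R.
    rewrite indicE; case: (boolP (x \in _)) => [|].
      rewrite inE => xab; rewrite big1// => j _.
      by rewrite indicE mem_set//; exact: xab.
    rewrite notin_setE => /oboxE xab; apply/esym/eqP; rewrite prodf_seq_eq0; apply/hasP.
    apply: contrapT => h; apply: xab => j; apply: contrapT => /negP xj; apply: h.
    exists j; rewrite ?mem_index_enum//= indicE memNset ?eqxx//=.
    by rewrite in_itv; exact/negP.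
  apply: cvg_big; first by move=> ?; exact: mul_continuous.
  by move=> j _; have [_ _ _] := hrr j; exact.
have tr01 k x : 0 <= tensor (r k) x <= 1.
  rewrite /tensor; apply/andP; split.
    by apply: prodr_ge0 => j _; have [_ _ /(_ k (x ord0 j))/andP[]] := hrr j.
  by apply: prodr_ile1 => j _; have [_ _ h _] := hrr j; exact: h.
have [] := @dominated_convergence _ _ R mu D mD
  (fun k x => (g x * tensor (r k) x)%:E) (fun x => (g x * \1_(obox a' b') x)%:E)
  (fun x => `|(g x)%:E|%E).
- by move=> k; have /integrableP[] := integrable_tensor mD gi (tr k).
- apply/measurable_EFinP; apply: measurable_funM.
    by apply/measurable_EFinP; have /integrableP[] := gi.
  by apply: measurable_funTS; apply: measurable_indic; exact: measurable_obox.
- apply: aeW => x _; apply: cvg_EFin; first by near=> k.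
  by apply: cvgM; [exact: cvg_cst|exact: cvr].
- exact: integrable_abse.
- apply: aeW => x k _; rewrite abse_EFin lee_fin normrM ler_piMr//.
  by have /andP[? ?] := tr01 k x; rewrite ger0_norm.
move=> _ _ cv; rewrite abE.
transitivity (\int[mu]_(x in D) (g x * \1_(obox a' b') x)%:E)%E.
  rewrite integral_mkcondr; apply: eq_integral => x _.
  by rewrite patchE indicE; case: ifP; rewrite ?mulr1 ?mulr0.
rewrite -(cvg_lim (@ereal_hausdorff R) cv).
apply: cvg_lim; first exact: ereal_hausdorff.
by apply: cvg_near_cst; near=> k; exact: g0.
Unshelve. all: by end_near. Qed.

(** Boxes are stable under intersection and generate the sigma-algebra, so the
    integral of g vanishes on every measurable part of the box. *)
Lemma ae_eq0_box p q g :
  mu.-integrable (obox p q) (EFin \o g) ->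
  (forall r, test_family p q r ->
    (\int[mu]_(x in obox p q) (g x * tensor r x)%:E = 0)%E) ->
  {ae mu, forall x, obox p q x -> g x = 0}.
Proof.
move=> gi g0; pose D := obox p q; have mD : measurable D by exact: measurable_obox.
pose P (S : set 'rV[R]_n) := (\int[mu]_(x in S `&` D) (g x)%:E = 0)%E.
have P0 a b : P (obox a b) by exact: integral_obox_eq0.
have PT : P setT.
  rewrite /P (_ : _ `&` D = obox p q `&` obox p q); last by rewrite setTI setIid.
  exact: P0.
have mgD : measurable_fun D (EFin \o g) by have /integrableP[] := gi.
have PS S : measurable S -> P S.
  move=> mS; apply: (@dynkin_induction _ 'rV[R]_n
    [set B | exists a b : 'I_n -> R, B = obox a b] P); last 1 first.
  - by rewrite -measurable_rV_gen_obox.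
  - exact: measurable_rV_gen_obox.
  - by move=> _ _ [a [b ->]] [a' [b' ->]]; rewrite oboxI; do 2!eexists.
  - exact: PT.
  - by move=> _ [a [b ->]].
  - move=> A mA PA; have := PT; rewrite /P setTI => DT.
    have DE : D = (A `&` D) `|` (~` A `&` D) by rewrite -setIUl setUv setTI.
    rewrite {1}DE integral_setU in DT; first by rewrite PA add0e in DT.
    + exact: measurableI.
    + by apply: measurableI => //; exact: measurableC.
    + by rewrite -DE.
    + apply/disj_setPS => x [[Ax _] [nAx _]]; exact: nAx.
  - move=> F mF tF PF; rewrite /P setI_bigcupl integral_bigcup.
    + by apply: eseries0 => k _ _; exact: PF.
    + apply/trivIsetP => i j _ _ ij; move/trivIsetP : tF => /(_ i j I I ij) Fij.
      by rewrite setIACA Fij set0I.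
    + by move=> k; exact: measurableI.
    + apply: integrableS gi => //; first by apply: bigcup_measurable => k _; exact: measurableI.
      by move=> x [k _ []].
have := @integral_ae_eq _ _ R mu D mD (cst 0%E) (EFin \o g) gi (@measurable_cst _ _ _ _ _ _).
move=> H; suff : ae_eq mu D (EFin \o g) (cst 0%E).
  by apply: filterS => x /= h Dx; have [] := h Dx.
apply: H => E ED mE; rewrite integral0; have := PS E mE.
by rewrite /P (_ : E `&` D = E)//; apply/setIidPl.
Qed.

End fundamental_lemma.

(** * Functions with zero weak gradient *)

Section weakly_constant.
Context {R : realType} {n : nat}.
Local Notation mu := (lebesgue_rV R n).
Implicit Types (r : 'I_n -> R -> R) (p q : 'I_n -> R) (w : 'rV[R]_n -> R).

(** Vanishing of the weak gradient, tested against tensors only. *)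
Definition weakly_cst p q w := forall i r, test_family p q r ->
  \int[mu]_(x in obox p q) (w x * partial i (tensor r) x) = 0.

Lemma partial_tensor p q r i : test_family p q r ->
  partial i (tensor r) = tensor (upd r i (derive1 (r i))).
Proof.
move=> tr; apply: partialE => x; apply: is_derive_tensor => t.
exact: smooth1_is_derive (tr i).1 _.
Qed.

Lemma test_family_derive p q r i : test_family p q r ->
  test_family p q (upd r i (derive1 (r i))).
Proof.
move=> tr; apply: test_family_upd => //; first exact: smooth1_derive1 (tr i).1.
exact: derive1_off (tr i).2.
Qed.

Lemma Rintegral_tensor_obox p q r : test_family p q r ->
  \int[mu]_(x in obox p q) tensor r x = \int[mu]_x tensor r x.
Proof.
move=> tr; rewrite Rintegral_mkcond; apply: eq_Rintegral => x _.
rewrite patchE; case: ifPn => //; rewrite notin_setE => xpq.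
by rewrite (tensor_off_obox tr).
Qed.

Lemma weakly_cst1 p q : weakly_cst p q (cst 1).
Proof.
move=> i r tr; under eq_Rintegral do rewrite mul1r.
have trd := test_family_derive i tr.
rewrite (partial_tensor i tr) Rintegral_tensor_obox//.
pose M := 1 + \sum_j (`|p j| + `|q j|).
have pqM j : `|p j| + `|q j| <= M.
  by rewrite /M (bigD1 j)//= addrCA lerDl addr_ge0// sumr_ge0.
have M0 : 0 < M by rewrite ltr_wpDr// sumr_ge0.
have out x : ~ cbox (fun=> - M) (fun=> M) x -> ~ obox p q x.
  apply: contra_not => /oboxE xpq; apply/cboxE => j.
  have := xpq j; have := pqM j; have := ler_norm (q j); have := ler_norm (- p j).
  by rewrite normrN; have := normr_ge0 (p j); have := normr_ge0 (q j); lra.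
rewrite /Rintegral; set J := integral _ _ _; suff -> : J = 0%E by [].
apply: (@integral_partial R n i M (tensor r)) => //.
- move=> x; apply: is_derive_tensor => t; exact: smooth1_is_derive (tr i).1 _.
- exact: tensor_family_continuous trd.
- by move=> x /out xpq; rewrite (tensor_off_obox tr).
- by move=> x /out xpq; rewrite (tensor_off_obox trd).
Qed.

Definition bumps p q : 'I_n -> R -> R := fun j => bumpf (p j) (q j).

Lemma test_family_bumps p q : test_family p q (bumps p q).
Proof. by move=> j; split; [exact: bump_smooth|exact: bump_off]. Qed.

(** Replacing one factor by a multiple of the bump changes the tensor by a
    partial derivative, so a weakly constant function does not see the
    replacement; the factor of proportionality is independent of w. *)
Lemma weakly_cst_swap p q r (s : seq 'I_n) : (forall j, p j < q j) ->
  test_family p q r ->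
  exists K, forall w, mu.-integrable (obox p q) (EFin \o w) -> weakly_cst p q w ->
    \int[mu]_(x in obox p q) (w x * tensor r x) = K *
    \int[mu]_(x in obox p q)
      (w x * tensor (fun j => if j \in s then bumps p q j else r j) x).
Proof.
move=> pq tr; elim: s => [|i s [K HK]]; first by exists 1 => w _ _; rewrite mul1r.
set rs := fun j => if j \in s then _ else _ in HK.
have trs : test_family p q rs.
  by move=> j; rewrite /rs; case: ifP => _; [exact: test_family_bumps|exact: tr].
have [c [g [sg g0 rsE]]] := smooth1_mod_derive (pq i) (trs i).1 (trs i).2.
have trg := test_family_upd trs sg g0.
have trb : test_family p q (upd rs i (bumps p q i)).
  by have [] := test_family_bumps p q i; exact: test_family_upd.
have trd : test_family p q (upd rs i (derive1 g)).
  apply: test_family_upd => //; [exact: smooth1_derive1|exact: derive1_off].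
exists (K * c) => w wi wc; rewrite HK// -mulrA; congr (_ * _).
have -> : (fun j => if j \in i :: s then bumps p q j else r j) = upd rs i (bumps p q i).
  by apply/funext => j; rewrite in_cons /upd /rs; case: eqP => [->|].
have mD : measurable (obox p q) by exact: measurable_obox.
have -> : \int[mu]_(x in obox p q) (w x * tensor rs x) =
    \int[mu]_(x in obox p q) (c * (w x * tensor (upd rs i (bumps p q i)) x) +
       w x * tensor (upd rs i (derive1 g)) x).
  apply: eq_Rintegral => x _; rewrite (tensor_bigD1 rs i) !tensor_upd rsE.
  by rewrite /bumps; ring.
rewrite RintegralD//; last 2 first.
- rewrite (_ : EFin \o _ = (fun x => c%:E *
    (EFin \o (fun x => w x * tensor (upd rs i (bumps p q i)) x)%R) x)%E)//.
  by apply: integrableZl => //; exact: integrable_tensor trb.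
- exact: integrable_tensor trd.
rewrite RintegralZl//; last exact: integrable_tensor trb.
have := wc i _ trg; rewrite (partial_tensor i trg).
rewrite (_ : upd (upd rs i g) i _ = upd rs i (derive1 g)) => [->|]; first by rewrite addr0.
by apply/funext => j; rewrite /upd eqxx; case: eqP.
Qed.

Lemma integral_bumps_gt0 p q : (forall j, p j < q j) ->
  0 < \int[mu]_(x in obox p q) tensor (bumps p q) x.
Proof.
move=> pq; have mD : measurable (obox p q) by exact: measurable_obox.
have tb := test_family_bumps p q.
have tpos x : obox p q x -> 0 < tensor (bumps p q) x.
  by move=> /oboxE xpq; apply: prodr_gt0 => j _; exact: bump_gt0.
rewrite lt_neqAle; apply/andP; split; last first.
  by apply: Rintegral_ge0 => x /tpos/ltW.
apply/eqP => /esym I0.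
have ti : mu.-integrable (obox p q) (EFin \o tensor (bumps p q)).
  apply: (@integrableS _ _ _ _ setT) => //.
  apply: (@continuous_cbox_integrable R n _ p q _ _).2.
    exact: tensor_family_continuous tb.
  by move=> x; apply: tensor_off => j; exact: (tb j).2.
have : ae_eq mu (obox p q) (EFin \o tensor (bumps p q)) (cst 0%E).
  apply/ae_eq_integral_abs => //; first by have /integrableP[] := ti.
  rewrite -[RHS]/(0%:E) -I0 /Rintegral fineK; last exact: integrable_fin_num.
  apply: eq_integral => x; rewrite inE => /tpos/ltW x0.
  by rewrite /= ger0_norm.
move=> [N [mN N0 sN]].
have : (mu (obox p q) <= mu N)%E.
  apply: le_measure; rewrite ?inE// => x xpq; apply: sN => /= /(_ xpq).
  by move=> []; apply/eqP; rewrite gt_eqF// tpos.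
by rewrite N0 leNgt lebesgue_rV_obox_gt0.
Qed.

Lemma integrable_cst_obox p q c : mu.-integrable (obox p q) (EFin \o cst c).
Proof.
have mD : measurable (obox p q) by exact: measurable_obox.
apply: measurable_bounded_integrable => //.
  apply: le_lt_trans (lebesgue_rV_cbox_lty p q).
  by apply: le_measure; rewrite ?inE//; [exact: measurable_cbox|exact: sub_obox_cbox].
by exists `|c|; split; [exact: num_real|move=> k ck x _; exact: ltW].
Qed.

(** The functions w and 1 see the same factor K. Choosing c so that w - c is
    orthogonal to the tensor of bumps thus makes it orthogonal to all
    tensors. *)
Lemma weakly_cst_ae p q w : (forall j, p j < q j) ->
  mu.-integrable (obox p q) (EFin \o w) -> weakly_cst p q w ->
  exists c, {ae mu, forall x, obox p q x -> w x = c}.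
Proof.
move=> pq wi wc; have mD : measurable (obox p q) by exact: measurable_obox.
set I := \int[mu]_(x in obox p q) tensor (bumps p q) x.
have I0 : 0 < I by exact: integral_bumps_gt0.
pose c := \int[mu]_(x in obox p q) (w x * tensor (bumps p q) x) / I.
have ci := integrable_cst_obox p q c.
exists c.
have : {ae mu, forall x, obox p q x -> w x - c = 0}.
  apply: ae_eq0_box.
    rewrite (_ : EFin \o _ = ((EFin \o w) \- (EFin \o cst c))%E)//.
    exact: integrableB.
  move=> r tr.
  have [K] := weakly_cst_swap (enum 'I_n) pq tr.
  have -> : (fun j => if j \in enum 'I_n then bumps p q j else r j) = bumps p q.
    by apply/funext => j; rewrite mem_enum.
  move=> HK; have Hw := HK w wi wc.
  have oi := integrable_cst_obox p q 1.
  have := HK (cst 1) oi (weakly_cst1 (p:=p) (q:=q)).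
  under eq_Rintegral do rewrite mul1r.
  under [X in _ * X]eq_Rintegral do rewrite mul1r.
  move=> H1.
  have ri : mu.-integrable (obox p q) (EFin \o tensor r).
    have := integrable_tensor mD oi tr; congr (integrable _ _ _).
    by apply/funext => x /=; rewrite mul1r.
  have : \int[mu]_(x in obox p q) ((w x - c) * tensor r x) = 0.
    under eq_Rintegral do rewrite mulrBl.
    rewrite RintegralB//; last 2 first.
    - exact: integrable_tensor tr.
    - exact: integrable_tensor tr.
    rewrite RintegralZl// Hw H1 -/I /c mulrCA divfK ?gt_eqF//.
    by rewrite subrr.
  rewrite /Rintegral => /eqP; rewrite fine_eq0 => [/eqP//|].
  apply: integrable_fin_num => //.
  apply: integrable_tensor tr => //.
  rewrite (_ : EFin \o _ = ((EFin \o w) \- (EFin \o cst c))%E)//.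
  exact: integrableB.
by apply: filterS => x h xpq; apply/eqP; rewrite -subr_eq0; apply/eqP; exact: h.
Qed.

End weakly_constant.

(** * From boxes to connected open sets *)

Section glue.
Context {R : realType} {n : nat}.
Local Notation mu := (lebesgue_rV R n).
Implicit Types (p q : 'I_n -> R) (w : 'rV[R]_n -> R).

Lemma obox_lt p q x : obox p q x -> forall j, p j < q j.
Proof. by move=> /oboxE h j; have /andP[/lt_trans] := h j; apply. Qed.

(** Boxes with a common point meet in a set of positive measure. *)
Lemma ae_cst_overlap p q p' q' w c c' x :
  {ae mu, forall y, obox p q y -> w y = c} ->
  {ae mu, forall y, obox p' q' y -> w y = c'} ->
  obox p q x -> obox p' q' x -> c = c'.
Proof.
move=> wc wc' xpq xpq'; apply/eqP/negPn/negP => /eqP cc'.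
have xI : (obox p q `&` obox p' q') x by [].
have [N [mN N0 sN]] : {ae mu, forall y, ~ (obox p q `&` obox p' q') y}.
  by move: wc wc'; apply: filterS2 => y h h' [/h wy /h' wy']; apply: cc'; rewrite -wy.
have : (mu (obox p q `&` obox p' q') <= mu N)%E.
  apply: le_measure; rewrite ?inE//; last by move=> y yI; apply: sN => /=; exact.
  by rewrite oboxI; exact: measurable_obox.
rewrite N0 oboxI leNgt lebesgue_rV_obox_gt0//.
by rewrite oboxI in xI; exact: obox_lt xI.
Qed.

Lemma ae_forall_countable (T : countType) (P : T -> 'rV[R]_n -> Prop) :
  (forall t, {ae mu, forall x, P t x}) -> {ae mu, forall x, forall t, P t x}.
Proof.
move=> aP.
have := @ae_foralln _ _ R mu (fun k x => if unpickle k is Some t then P t x else True).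
move=> H; have {H} : \forall x \ae mu, forall k, if unpickle k is Some t then P t x else True.
  apply: H => k; case: (unpickle k) => [t|]; first exact: aP.
  exact: aeW.
by apply: filterS => x h t; have := h (pickle t); rewrite pickleK.
Qed.

(** The union of the boxes on which the value is c is open, and it is closed
    in Omega because a box that meets it carries the same constant. Rational
    boxes then leave only countably many null sets to exclude. *)
Lemma connected_ae_cst (Omega : set 'rV[R]_n) w : open Omega -> connected Omega ->
  (forall p q, (forall j, p j < q j) -> cbox p q `<=` Omega ->
    exists c, {ae mu, forall x, obox p q x -> w x = c}) ->
  exists c, {ae mu, forall x, Omega x -> w x = c}.
Proof.
move=> oO cO wbox.
have [->|/set0P[x0 Ox0]] := eqVneq Omega set0.
  by exists 0; apply: aeW.
have loc x : Omega x -> exists p q c, [/\ obox p q x, cbox p q `<=` Omega &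
    {ae mu, forall x, obox p q x -> w x = c}].
  move=> Ox; have [p [q [xpq pqO]]] := open_rat_cbox oO Ox.
  have [c wc] := wbox _ _ (obox_lt xpq) pqO.
  by exists (ratr \o p), (ratr \o q), c.
have [p0 [q0 [c [x0pq pqO0 wc0]]]] := loc _ Ox0.
pose S : set 'rV[R]_n := \bigcup_(pq in [set pq : ('I_n -> R) * ('I_n -> R) |
    cbox pq.1 pq.2 `<=` Omega /\
    {ae mu, forall x, obox pq.1 pq.2 x -> w x = c}]) obox pq.1 pq.2.
have oS : open S by apply: bigcup_open => pq _; exact: open_obox.
have SO : S `<=` Omega by move=> x [pq [pqO _]] /sub_obox_cbox/pqO.
have SE : S = Omega.
  apply: cO.
  - by exists x0, (p0, q0).
  - by exists S => //; apply/seteqP; split => x; [split; [exact: SO|]|case].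
  - exists (closure S); first exact: closed_closure.
    apply/seteqP; split => [x Sx|x [Ox clSx]].
      by split; [exact: SO|exact: subset_closure].
    have [p [q [c' [xpq pqO wc']]]] := loc _ Ox.
    have [y [[pq [pqO' wcy] ypq'] ypq]] : S `&` obox p q !=set0.
      by apply: clSx; apply: open_nbhs_nbhs; split => //; exact: open_obox.
    have cc' := ae_cst_overlap wcy wc' ypq' ypq; rewrite -cc' in wc'.
    by exists (p, q).
exists c.
have : {ae mu, forall x, forall pq : {ffun 'I_n -> rat} * {ffun 'I_n -> rat},
    cbox (ratr \o pq.1) (ratr \o pq.2) `<=` Omega ->
    obox (ratr \o pq.1) (ratr \o pq.2) x -> w x = c}.
  apply: ae_forall_countable => pq.
  have [pqO|pqO] := pselect (cbox (ratr \o pq.1 : 'I_n -> R) (ratr \o pq.2) `<=` Omega); last first.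
    by apply: aeW => x /pqO.
  have [[y ypq]|ne] := pselect (obox (ratr \o pq.1 : 'I_n -> R) (ratr \o pq.2) !=set0); last first.
    by apply: aeW => x _ xpq; exfalso; apply: ne; exists x.
  have [c' wc'] := wbox _ _ (obox_lt ypq) pqO.
  have : S y by rewrite SE; apply: pqO; exact: sub_obox_cbox.
  move=> [pq' [_ wcy] ypq'].
  have cc' := ae_cst_overlap wcy wc' ypq' ypq; rewrite -cc' in wc'.
  by move: wc'; apply: filterS => x h _; exact: h.
apply: filterS => x h Ox; have [p [q [xpq pqO]]] := open_rat_cbox oO Ox.
exact: h (p, q) pqO xpq.
Qed.

Lemma Rintegral_sub (D B : set 'rV[R]_n) w : B `<=` D ->
  (forall x, ~ B x -> w x = 0) ->
  \int[mu]_(x in D) w x = \int[mu]_(x in B) w x.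
Proof.
move=> BD w0; rewrite [LHS]Rintegral_mkcond [RHS]Rintegral_mkcond.
apply: eq_Rintegral => x _; rewrite !patchE.
case: (ifPn (x \in B)) => [|]; rewrite ?inE ?notin_setE => xB.
  by rewrite mem_set//; exact: BD.
by case: ifP => // _; exact: w0.
Qed.

(** The open set is a countable union of boxes, on each of which the local
    form applies. *)
Lemma ae_eq0_open (Omega : set 'rV[R]_n) w : open Omega ->
  mu.-integrable Omega (EFin \o w) ->
  (forall p q r, cbox p q `<=` Omega -> test_family p q r ->
    \int[mu]_(x in Omega) (w x * tensor r x) = 0) ->
  {ae mu, forall x, Omega x -> w x = 0}.
Proof.
move=> oO wi w0; have mO := measurable_open_rV oO.
have : {ae mu, forall x, forall pq : {ffun 'I_n -> rat} * {ffun 'I_n -> rat},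
    cbox (ratr \o pq.1) (ratr \o pq.2) `<=` Omega ->
    obox (ratr \o pq.1) (ratr \o pq.2) x -> w x = 0}.
  apply: ae_forall_countable => pq.
  set p := ratr \o pq.1 : 'I_n -> R; set q := ratr \o pq.2 : 'I_n -> R.
  have [pqO|pqO] := pselect (cbox p q `<=` Omega); last first.
    by apply: aeW => x /pqO.
  have pqO' : obox p q `<=` Omega by move=> x /sub_obox_cbox/pqO.
  have mD : measurable (obox p q) by exact: measurable_obox.
  have wD : mu.-integrable (obox p q) (EFin \o w) by exact: integrableS wi.
  have : {ae mu, forall x, obox p q x -> w x = 0}.
    apply: ae_eq0_box => // r tr.
    have : \int[mu]_(x in obox p q) (w x * tensor r x) = 0.
      rewrite -[RHS](w0 p q r pqO tr) (Rintegral_sub pqO')// => x xpq.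
      by rewrite (tensor_off_obox tr xpq) mulr0.
    rewrite /Rintegral => /eqP; rewrite fine_eq0 => [/eqP//|].
    by apply: integrable_fin_num => //; exact: integrable_tensor tr.
  by apply: filterS => x h _; exact: h.
apply: filterS => x h Ox; have [p [q [xpq pqO]]] := open_rat_cbox oO Ox.
exact: h (p, q) pqO xpq.
Qed.

End glue.

(** * Square integrable functions on a measurable set *)

(** A quadratic polynomial without sign change has nonpositive discriminant. *)
Lemma discriminant_le (R : rcfType) (a b c : R) : 0 <= c ->
  (forall t, 0 <= a + 2 * t * b + t ^+ 2 * c) ->
  `|b| <= Num.sqrt a * Num.sqrt c.
Proof.
move=> c0 H; have a0 : 0 <= a by have := H 0; rewrite mulr0 mul0r expr0n mul0r !addr0.
rewrite -sqrtrM// -sqrtr_sqr; apply: ler_wsqrtr.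
move: c0; rewrite le_eqVlt => /predU1P[c0|c0].
  have [->|b0] := eqVneq b 0; first by rewrite expr0n /= -c0 mulr0.
  have := H (- (a + 1) / (2 * b)); rewrite -c0 mulr0 addr0.
  rewrite (_ : 2 * _ * b = - (a + 1)); last by field.
  by rewrite opprD addrA subrr sub0r oppr_ge0 ler10.
have := H (- b / c).
rewrite (_ : a + _ + _ = a - b ^+ 2 / c); last by field; rewrite gt_eqF.
by rewrite subr_ge0 ler_pdivrMr.
Qed.

Section L2.
Context {d} {T : measurableType d} {R : realType}.
Variables (mu : {measure set T -> \bar R}) (D : set T).
Hypothesis mD : measurable D.
Implicit Types (f g h : T -> R) (c : R).

Lemma integrable_Dr f g : mu.-integrable D (EFin \o f) ->
  mu.-integrable D (EFin \o g) -> mu.-integrable D (EFin \o (fun x => f x + g x)).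
Proof. by move=> fi gi; have := integrableD mD fi gi. Qed.

Lemma integrable_Br f g : mu.-integrable D (EFin \o f) ->
  mu.-integrable D (EFin \o g) -> mu.-integrable D (EFin \o (fun x => f x - g x)).
Proof. by move=> fi gi; have := integrableB mD fi gi. Qed.

Lemma integrable_Zr c f : mu.-integrable D (EFin \o f) ->
  mu.-integrable D (EFin \o (fun x => c * f x)).
Proof. by move=> fi; have := integrableZl mD c fi. Qed.

(** Relative to D, without extension by zero, so that it combines with
    measurability and integrability on D. *)
Definition L2 f := measurable_fun D f /\
  mu.-integrable D (EFin \o (fun x => f x ^+ 2)).

Definition dotL2 f g : R := \int[mu]_(x in D) (f x * g x).

Lemma L2_mul f g : L2 f -> L2 g ->
  mu.-integrable D (EFin \o (fun x => f x * g x)).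
Proof.
move=> [mf f2] [mg g2].
have fg2 : mu.-integrable D
    ((EFin \o (fun x => f x ^+ 2)%R) \+ (EFin \o (fun x => g x ^+ 2)%R))%E.
  exact: integrableD.
apply: le_integrable fg2 => //; first by apply/measurable_EFinP; exact: measurable_funM.
move=> x _ /=; rewrite lee_fin [leRHS]ger0_norm ?addr_ge0 ?sqr_ge0//.
rewrite -[f x ^+ 2]real_normK ?num_real// -[g x ^+ 2]real_normK ?num_real// normrM.
have := sqr_ge0 (`|f x| - `|g x|); have := normr_ge0 (f x); have := normr_ge0 (g x).
by set a := `|f x|; set b := `|g x|; nra.
Qed.

Lemma L2D f g : L2 f -> L2 g -> L2 (fun x => f x + g x).
Proof.
move=> Lf Lg; split; first by apply: measurable_funD; [exact: Lf.1|exact: Lg.1].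
have fg := L2_mul Lf Lg.
rewrite (_ : EFin \o _ = (fun x => (f x ^+ 2)%:E +
   (2%:E * (EFin \o (fun x => f x * g x)%R) x + (g x ^+ 2)%:E))%E).
  apply: integrableD => //; first exact: Lf.2.
  by apply: integrableD => //; [exact: integrableZl|exact: Lg.2].
by apply/funext => x /=; rewrite -EFinM -!EFinD; congr (_%:E); ring.
Qed.

Lemma L2Z c f : L2 f -> L2 (fun x => c * f x).
Proof.
move=> [mf f2]; split; first by apply: measurable_funM => //; exact: measurable_cst.
rewrite (_ : EFin \o _ = (fun x => (c ^+ 2)%:E * (EFin \o (fun x => f x ^+ 2)%R) x)%E).
  exact: integrableZl.
by apply/funext => x /=; rewrite exprMn EFinM.
Qed.

Lemma L2B f g : L2 f -> L2 g -> L2 (fun x => f x - g x).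
Proof.
move=> Lf Lg; have := L2D Lf (L2Z (-1) Lg).
by under eq_fun do rewrite mulN1r.
Qed.

Lemma L2_0 : L2 (fun=> 0).
Proof.
split; first exact: measurable_cst.
rewrite (_ : EFin \o _ = cst 0%E); first exact: integrable0.
by apply/funext => x /=; rewrite expr0n.
Qed.

Lemma L2_sum (I : Type) (s : seq I) (F : I -> T -> R) :
  (forall i, L2 (F i)) -> L2 (fun x => \sum_(i <- s) F i x).
Proof.
move=> LF; elim: s => [|i s ih].
  by under eq_fun do rewrite big_nil; exact: L2_0.
by under eq_fun do rewrite big_cons; exact: L2D.
Qed.

Lemma L2_mul_bounded (a : T -> R) f (M : R) : measurable_fun D a ->
  {ae mu, forall x, D x -> `|a x| <= M} -> L2 f -> L2 (fun x => a x * f x).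
Proof.
move=> ma aM [mf f2]; have maf : measurable_fun D (fun x => a x * f x) by exact: measurable_funM.
split => //; apply/integrableP; split.
  by apply/measurable_EFinP; exact: measurable_funX.
have M2 : mu.-integrable D (fun x => ((M ^+ 2)%:E * (EFin \o (fun x => f x ^+ 2)%R) x)%E).
  exact: integrableZl.
have /integrableP[mM] := M2; apply: le_lt_trans; apply: ae_ge0_le_integral => //.
- apply: measurableT_comp => //.
  by apply/measurable_EFinP; exact: measurable_funX.
- exact: measurableT_comp.
- apply: filterS aM => x h Dx /=; rewrite lee_fin exprMn !normrM ler_wpM2r//.
  rewrite -!normrM -!expr2 !ger0_norm ?sqr_ge0// -[leLHS]real_normK ?num_real//.
  by apply: lerXn2r; rewrite ?nnegrE ?normr_ge0// (le_trans _ (h Dx)) ?h.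
Qed.

Lemma L2_bounded f (M : R) : (mu D < +oo)%E -> measurable_fun D f ->
  (forall x, D x -> `|f x| <= M) -> L2 f.
Proof.
move=> Dfin mf fM; split => //; apply: measurable_bounded_integrable => //.
  exact: measurable_funX.
exists (M ^+ 2); split; first exact: num_real.
move=> k Mk x Dx; apply: le_trans (ltW Mk); rewrite /= normrX.
by apply: lerXn2r; rewrite ?nnegrE ?normr_ge0 ?(le_trans _ (fM x Dx))// fM.
Qed.

Lemma Rintegral_ae_eq f g : measurable_fun D f -> measurable_fun D g ->
  {ae mu, forall x, D x -> f x = g x} ->
  \int[mu]_(x in D) f x = \int[mu]_(x in D) g x.
Proof.
move=> mf mg fg; rewrite /Rintegral; congr fine; apply: ae_eq_integral => //.
- exact/measurable_EFinP.
- exact/measurable_EFinP.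
- by apply: filterS fg => x h Dx; rewrite h.
Qed.

Lemma Rintegral_sqr_eq0 f : L2 f -> \int[mu]_(x in D) (f x ^+ 2) = 0 ->
  {ae mu, forall x, D x -> f x = 0}.
Proof.
move=> [mf f2] I0.
have : ae_eq mu D (EFin \o (fun x => f x ^+ 2)) (cst 0%E).
  apply/ae_eq_integral_abs => //; first by have /integrableP[] := f2.
  rewrite -[RHS]/(0%:E) -I0 /Rintegral fineK; last exact: integrable_fin_num.
  by apply: eq_integral => x _; rewrite /= ger0_norm ?sqr_ge0.
apply: filterS => x /= h Dx; have /eqP := h Dx.
by rewrite eqe sqrf_eq0 => /eqP.
Qed.

Lemma dotL2Dr f g h : L2 f -> L2 g -> L2 h ->
  dotL2 f (fun x => g x + h x) = dotL2 f g + dotL2 f h.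
Proof.
move=> Lf Lg Lh; rewrite /dotL2 -RintegralD; [|exact: mD|exact: L2_mul|exact: L2_mul].
by apply: eq_Rintegral => x _; rewrite mulrDr.
Qed.

Lemma dotL2Zr c f g : L2 f -> L2 g -> dotL2 f (fun x => c * g x) = c * dotL2 f g.
Proof.
move=> Lf Lg; rewrite /dotL2 -RintegralZl; [|exact: mD|exact: L2_mul].
by apply: eq_Rintegral => x _; rewrite mulrCA.
Qed.

Lemma dotL2C f g : dotL2 f g = dotL2 g f.
Proof. by apply: eq_Rintegral => x _; rewrite mulrC. Qed.

Lemma dotL2_ge0 f : 0 <= dotL2 f f.
Proof. by apply: Rintegral_ge0 => x _; rewrite -expr2 sqr_ge0. Qed.

Lemma dotL2_CS f g : L2 f -> L2 g ->
  `|dotL2 f g| <= Num.sqrt (dotL2 f f) * Num.sqrt (dotL2 g g).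
Proof.
move=> Lf Lg; apply: discriminant_le; first exact: dotL2_ge0.
move=> t; have := dotL2_ge0 (fun x => f x + t * g x).
have Lt := L2Z t Lg; have Lft := L2D Lf Lt.
rewrite dotL2Dr// dotL2Zr// ![dotL2 (fun x => f x + _) _]dotL2C !dotL2Dr// !dotL2Zr//.
by rewrite [dotL2 g f]dotL2C; congr (_ <= _); ring.
Qed.

Lemma in_Lfun2P f : (f \_ D : T -> R) \in Lfun mu 2%:E <-> L2 f.
Proof.
have sqrE : EFin \o (fun x => (f \_ D) x ^+ 2) = (EFin \o (fun x => f x ^+ 2)) \_ D.
  by apply/funext => x /=; rewrite !patchE; case: ifP => //; rewrite expr0n.
split=> [Lf|[mf f2]].
  have := Lf; rewrite inE => /andP[+ _]; rewrite inE => /= mf; split.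
    exact/(measurable_restrictT _ mD).
  by rewrite integrable_mkcond// -sqrE; exact: Lfun2_integrable_sqr.
rewrite inE; apply/andP; split; rewrite inE /=.
  by apply/(measurable_restrictT _ mD).
have : (\int[mu]_x `|(f \_ D) x|%:E `^ 2 < +oo)%E.
  rewrite (eq_integral (fun x => (EFin \o (fun x => (f \_ D) x ^+ 2)) x)).
    rewrite sqrE -integral_mkcond; have /integrableP[_] := f2.
    by under eq_integral => x _ do rewrite /= ger0_norm ?sqr_ge0//.
  by move=> x _ /=; rewrite powR_mulrn// real_normK// num_real.
rewrite /finite_norm unlock /= => h; apply: poweR_lty; exact: h.
Qed.

Lemma Lnorm2E f : L2 f ->
  'N[mu]_2%:E[EFin \o (f \_ D)]%E = (Num.sqrt (dotL2 f f))%:E.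
Proof.
move=> Lf; rewrite unlock /=.
rewrite (_ : (\int[mu]_x _)%E = (dotL2 f f)%:E).
  by rewrite poweR12_sqrt// lee_fin dotL2_ge0.
rewrite /dotL2 /Rintegral fineK; last by apply: integrable_fin_num => //; exact: L2_mul.
rewrite [RHS]integral_mkcond; apply: eq_integral => x _.
rewrite !patchE; case: ifP => _; last by rewrite normr0 powR0.
by rewrite powR_mulrn// real_normK ?num_real// expr2.
Qed.

End L2.

(** * Square integrable vector fields and the energy form *)

Section energy.
Context {R : realType} {n : nat}.
Local Notation E := 'rV[R]_n.
Local Notation mu := (lebesgue_rV R n).
Variable Omega : set E.
Hypothesis mO : measurable Omega.
Implicit Types (G H K : E -> E) (c : R) (A : E -> 'M[R]_n).

Definition L2v G := forall i, L2 mu Omega (fun x => G x ord0 i).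

Definition dotv G H : R := \int[mu]_(x in Omega) dot (G x) (H x).

Lemma L2v_axpy c G H : L2v G -> L2v H -> L2v (fun x => G x + c *: H x).
Proof.
move=> LG LH i; under eq_fun do rewrite !mxE.
by apply: L2D => //; exact: L2Z.
Qed.

Lemma dotvE G H : L2v G -> L2v H ->
  dotv G H = \sum_i dotL2 mu Omega (fun x => G x ord0 i) (fun x => H x ord0 i) /\
  mu.-integrable Omega (EFin \o (fun x => dot (G x) (H x))).
Proof.
move=> LG LH; rewrite /dotv /dot.
elim: (index_enum _) => [|i s [IH1 IH2]].
  rewrite big_nil; under eq_Rintegral do rewrite big_nil.
  rewrite Rintegral_cst ?mul0r//; split => //.
  by under eq_fun do rewrite big_nil; exact: integrable0.
have fi := L2_mul mO (LG i) (LH i).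
under eq_Rintegral do rewrite big_cons.
rewrite RintegralD// IH1 big_cons; split => //.
under eq_fun do rewrite big_cons.
exact: integrable_Dr.
Qed.

Lemma integrable_dot G H : L2v G -> L2v H ->
  mu.-integrable Omega (EFin \o (fun x => dot (G x) (H x))).
Proof. by move=> LG LH; have [] := dotvE LG LH. Qed.

Lemma dotC (x y : E) : dot x y = dot y x.
Proof. by apply: eq_bigr => i _; rewrite mulrC. Qed.

Lemma dotvC G H : dotv G H = dotv H G.
Proof. by apply: eq_Rintegral => x _; rewrite dotC. Qed.

Lemma dotv_axpyr c G H K : L2v G -> L2v H -> L2v K ->
  dotv G (fun x => H x + c *: K x) = dotv G H + c * dotv G K.
Proof.
move=> LG LH LK; have iGH := integrable_dot LG LH; have iGK := integrable_dot LG LK.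
rewrite /dotv -RintegralZl// -RintegralD//; last exact: integrable_Zr.
apply: eq_Rintegral => x _; rewrite /dot mulr_sumr -big_split /=.
by apply: eq_bigr => i _; rewrite !mxE; ring.
Qed.

Lemma dot_ge0 (x : E) : 0 <= dot x x.
Proof. by apply: sumr_ge0 => i _; rewrite -expr2 sqr_ge0. Qed.

Lemma dotv_ge0 G : 0 <= dotv G G.
Proof. by apply: Rintegral_ge0 => x _; exact: dot_ge0. Qed.

Lemma dotv_CS G H : L2v G -> L2v H ->
  `|dotv G H| <= Num.sqrt (dotv G G) * Num.sqrt (dotv H H).
Proof.
move=> LG LH; apply: discriminant_le; first exact: dotv_ge0.
move=> t; have := dotv_ge0 (fun x => G x + t *: H x).
have LGt := L2v_axpy t LG LH.
rewrite dotv_axpyr// ![dotv (fun x => G x + _) _]dotvC !dotv_axpyr//.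
by rewrite [dotv H G]dotvC; congr (_ <= _); ring.
Qed.

Lemma dotv_eq0 G : L2v G -> dotv G G = 0 ->
  {ae mu, forall x, Omega x -> G x = 0}.
Proof.
move=> LG; rewrite (dotvE LG LG).1 => /eqP.
rewrite psumr_eq0; last by move=> i _; exact: dotL2_ge0.
move=> /allP h; have : {ae mu, forall x, forall i : 'I_n, Omega x -> G x ord0 i = 0}.
  apply: ae_forall_countable => i; apply: Rintegral_sqr_eq0 => //.
  have := h i (mem_index_enum _) => /eqP; rewrite /dotL2.
  by under eq_Rintegral do rewrite -expr2.
by apply: filterS => x Gx Ox; apply/rowP => i; rewrite mxE Gx.
Qed.

Lemma L2_enorm G : L2v G -> L2 mu Omega (fun x => enorm (G x)).
Proof.
move=> LG; have iG := integrable_dot LG LG; split.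
  rewrite /enorm; apply: measurableT_comp.
    by apply: continuous_measurable_fun; exact: sqrt_continuous.
  by apply/measurable_EFinP; have /integrableP[] := iG.
move: iG; congr (integrable _ _ _); apply/funext => x /=.
by rewrite /enorm sqr_sqrtr// dot_ge0.
Qed.

Lemma norm0_vecE G : L2v G -> norm0_vec Omega G = (Num.sqrt (dotv G G))%:E.
Proof.
move=> LG; rewrite /norm0_vec /norm0 Lnorm2E//; last exact: L2_enorm.
congr (Num.sqrt _)%:E; apply: eq_Rintegral => x _.
by rewrite -expr2 /enorm sqr_sqrtr// dot_ge0.
Qed.

Lemma dotv_ae_eq G H G' H' : L2v G -> L2v H -> L2v G' -> L2v H' ->
  {ae mu, forall x, Omega x -> G x = G' x} ->
  {ae mu, forall x, Omega x -> H x = H' x} -> dotv G H = dotv G' H'.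
Proof.
move=> LG LH LG' LH' eG eH; apply: Rintegral_ae_eq => //.
- by apply/measurable_EFinP; have /integrableP[] := integrable_dot LG LH.
- by apply/measurable_EFinP; have /integrableP[] := integrable_dot LG' LH'.
- by move: eG eH; apply: filterS2 => x eG eH Ox; rewrite eG// eH.
Qed.

Lemma Rintegral_ae_ge0 f : mu.-integrable Omega (EFin \o f) ->
  {ae mu, forall x, Omega x -> 0 <= f x} -> 0 <= \int[mu]_(x in Omega) f x.
Proof.
move=> fi f0; have mf : measurable_fun Omega f.
  by apply/measurable_EFinP; have /integrableP[] := fi.
rewrite (@Rintegral_ae_eq _ _ _ mu Omega mO f (fun x => `|f x|))//.
- exact: Rintegral_ge0.
- exact: measurableT_comp.
- by move: f0; apply: filterS => x f0 Ox /=; rewrite ger0_norm// f0.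
Qed.

Section coefficient.
Variables (A : E -> 'M[R]_n) (alpha beta : R).
Hypothesis hA : forall i j, in_Lp Omega +oo%E (fun x => A x i j).
Hypothesis sA : {ae mu, forall x, Omega x -> (A x)^T = A x}.
Hypothesis alpha0 : 0 < alpha.
Hypothesis eA : uniformly_elliptic Omega A alpha beta.

Lemma coef_bounded i j : measurable_fun Omega (fun x => A x i j) /\
  exists M : R, {ae mu, forall x, Omega x -> `|A x i j| <= M}.
Proof.
have := hA i j; rewrite /in_Lp inE => /andP[+ +]; rewrite !inE /= => mf fn.
split; first exact/(measurable_restrictT _ mO).
move: fn; rewrite /finite_norm unlock; case: ifPn => [mu0 ess|mu0 _]; last first.
  exists 0; apply: measure0_ae; apply/eqP; rewrite eq_le measure_ge0 andbT.
  by rewrite leNgt.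
have H := ess_sup_ge mu (abse \o (EFin \o ((fun x => A x i j) \_ Omega))).
set m := ess_sup _ _ in ess H.
exists (fine m).
move: H; apply: filterS => x /= + Ox.
rewrite patchE mem_set//.
by move: ess; case: m => //= r _; rewrite lee_fin.
Qed.

Lemma L2v_flux G : L2v G -> L2v (flux A G).
Proof.
move=> LG i; rewrite /flux; under eq_fun do rewrite mxE.
apply: L2_sum => // k; under eq_fun do rewrite mxE mulrC.
by have [mA [M AM]] := coef_bounded i k; apply: L2_mul_bounded AM _.
Qed.

Definition energy G H := dotv (flux A G) H.

Lemma dot_mulmx (x y : E) : dot x y = (x *m y^T) ord0 ord0.
Proof. by rewrite mxE; apply: eq_bigr => i _; rewrite !mxE. Qed.

Lemma energyC G H : L2v G -> L2v H -> energy G H = energy H G.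
Proof.
move=> LG LH; apply: Rintegral_ae_eq => //.
- by apply/measurable_EFinP; have /integrableP[] := integrable_dot (L2v_flux LG) LH.
- by apply/measurable_EFinP; have /integrableP[] := integrable_dot (L2v_flux LH) LG.
move: sA; apply: filterS => x Ax Ox; rewrite /flux Ax// !dot_mulmx.
by rewrite -[in LHS](trmxK (_ *m (H x)^T)) [LHS]mxE !trmx_mul trmxK Ax// mulmxA.
Qed.

Lemma energy_axpyr c G H K : L2v G -> L2v H -> L2v K ->
  energy G (fun x => H x + c *: K x) = energy G H + c * energy G K.
Proof. by move=> LG LH LK; apply: dotv_axpyr => //; exact: L2v_flux. Qed.

Lemma energy_axpyl c G H K : L2v G -> L2v H -> L2v K ->
  energy (fun x => H x + c *: K x) G = energy H G + c * energy K G.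
Proof.
move=> LG LH LK; rewrite energyC//; last exact: L2v_axpy.
by rewrite energy_axpyr// [energy G H]energyC// [energy G K]energyC.
Qed.

Lemma energy_elliptic G : L2v G -> alpha * dotv G G <= energy G G.
Proof.
move=> LG; have iG := integrable_dot LG LG; have iA := integrable_dot (L2v_flux LG) LG.
rewrite -subr_ge0 /energy /dotv -RintegralZl// -RintegralB//; last exact: integrable_Zr.
apply: Rintegral_ae_ge0.
  by apply: integrable_Br => //; exact: integrable_Zr.
move: eA; apply: filterS => x h Ox; have /andP[+ _] := h Ox (G x).
rewrite subr_ge0 /enorm sqr_sqrtr ?dot_ge0// => /le_trans; apply.
rewrite /flux dot_mulmx.
have <- : (G x *m A x *m (G x)^T)^T = G x *m (A x)^T *m (G x)^T.
  by rewrite !trmx_mul trmxK mulmxA.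
by rewrite [leRHS]mxE.
Qed.

Lemma energy_ge0 G : L2v G -> 0 <= energy G G.
Proof.
by move=> LG; apply: le_trans (energy_elliptic LG); rewrite mulr_ge0 ?dotv_ge0// ltW.
Qed.

Lemma energy_CS G H : L2v G -> L2v H ->
  `|energy G H| <= Num.sqrt (energy G G) * Num.sqrt (energy H H).
Proof.
move=> LG LH; apply: discriminant_le; first exact: energy_ge0.
move=> t; have LGt := L2v_axpy t LG LH; have := energy_ge0 LGt.
rewrite energy_axpyr// !energy_axpyl//.
by rewrite [energy H G]energyC//; congr (_ <= _); ring.
Qed.

Lemma energy_eq0 G : L2v G -> energy G G = 0 ->
  {ae mu, forall x, Omega x -> G x = 0}.
Proof.
move=> LG G0; apply: dotv_eq0 => //; apply/eqP; rewrite eq_le dotv_ge0 andbT.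
by have := energy_elliptic LG; rewrite G0 pmulr_rle0.
Qed.

End coefficient.
End energy.

(** * Weak gradients *)

Section weak_gradients.
Context {R : realType} {n : nat}.
Local Notation E := 'rV[R]_n.
Local Notation mu := (lebesgue_rV R n).
Variable Omega : set E.
Hypothesis oO : open Omega.
Hypothesis bO : bounded_set Omega.
Implicit Types (u v w f g phi psi : E -> R) (G H : E -> E).
Local Notation L2 := (L2 mu Omega).
Local Notation dotL2 := (dotL2 mu Omega).

Let mO : measurable Omega := measurable_open_rV oO.

Lemma Omega_lty : (mu Omega < +oo)%E.
Proof. exact: bounded_lebesgue_rV_lty. Qed.

Lemma L2_cst (c : R) : L2 (fun=> c).
Proof.
apply: (@L2_bounded _ _ _ _ _ mO _ `|c| Omega_lty) => //.
Qed.

Lemma L2_integrable f : L2 f -> mu.-integrable Omega (EFin \o f).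
Proof.
move=> Lf; have := L2_mul mO Lf (L2_cst 1); congr (integrable _ _ _).
by apply/funext => x /=; rewrite mulr1.
Qed.

Lemma continuous_test phi : test_fun Omega phi -> continuous phi.
Proof. by move=> [/(_ [::])[]]. Qed.

Lemma continuous_partial_test phi i : test_fun Omega phi -> continuous (partial i phi).
Proof. by move=> [/(_ [:: i])[]]. Qed.

Lemma is_derive_test phi i x : test_fun Omega phi ->
  is_derive x (delta_mx ord0 i) phi (partial i phi x).
Proof. by move=> [/(_ [::])[_ dphi] _ _]; apply: is_derive_partial => y; exact: dphi. Qed.

(** The complement of the support is open, so the derivatives vanish there
    together with the function. *)
Lemma test_off phi x : test_fun Omega phi -> ~ Omega x ->
  phi x = 0 /\ forall i, partial i phi x = 0.
Proof.
move=> [_ _ SO] Ox; have nSx : ~ closure [set x | phi x != 0] x by move=> /SO.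
split=> [|i].
  by apply/eqP; apply: contrapT => /negP px; apply: nSx; exact: subset_closure.
rewrite /partial (@near_eq_derive _ _ _ phi (cst 0)) ?derive_cst//.
have : nbhs x (~` closure [set x | phi x != 0]).
  by apply: open_nbhs_nbhs; split => //; exact/closed_openC/closed_closure.
apply: filterS => y nSy; apply/eqP; apply: contrapT => /negP py.
by apply: nSy; exact: subset_closure.
Qed.

Lemma continuous_off_bounded f : continuous f -> (forall x, ~ Omega x -> f x = 0) ->
  exists M, forall x, `|f x| <= M.
Proof.
move=> cf f0; have [M M0 OM] := bounded_sub_cbox bO.
apply: (@continuous_cbox_integrable R n f (fun=> - M) (fun=> M) cf _).1.
by move=> x xM; apply: f0 => /OM.
Qed.

Lemma L2_continuous_off f : continuous f -> (forall x, ~ Omega x -> f x = 0) -> L2 f.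
Proof.
move=> cf f0; have [M fM] := continuous_off_bounded cf f0.
apply: (@L2_bounded _ _ _ _ _ mO _ M Omega_lty) => //.
by apply: measurable_funTS; exact: continuous_measurable_rV.
Qed.

Lemma L2_test phi : test_fun Omega phi -> L2 phi.
Proof.
move=> tp; apply: L2_continuous_off; first exact: continuous_test.
by move=> x /(test_off tp)[].
Qed.

Lemma L2_partial_test phi i : test_fun Omega phi -> L2 (partial i phi).
Proof.
move=> tp; apply: L2_continuous_off; first exact: continuous_partial_test.
by move=> x /(test_off tp)[].
Qed.

Lemma L2v_gradient_test phi : test_fun Omega phi -> L2v Omega (gradient phi).
Proof. by move=> tp i; under eq_fun do rewrite mxE; exact: L2_partial_test. Qed.

(** Since g' vanishes off the bounded set Omega, the integral extends to the
    whole space, where integral_partial applies. *)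
Lemma Rintegral_derive_off (i : 'I_n) g g' :
  (forall x, is_derive x (delta_mx ord0 i) g (g' x)) -> continuous g' ->
  (forall x, ~ Omega x -> g x = 0) -> (forall x, ~ Omega x -> g' x = 0) ->
  \int[mu]_(x in Omega) g' x = 0.
Proof.
move=> dg cg' g0 g'0; have [M M0 OM] := bounded_sub_cbox bO.
rewrite -(@Rintegral_sub R n setT Omega g')//; rewrite /Rintegral.
set J := integral _ _ _; suff -> : J = 0%E by [].
apply: (@integral_partial R n i M g) => //.
- by move=> x xM; apply: g0 => /OM.
- by move=> x xM; apply: g'0 => /OM.
Qed.

Lemma integral_partial_test phi i : test_fun Omega phi ->
  \int[mu]_(x in Omega) partial i phi x = 0.
Proof.
move=> tp; apply: (@Rintegral_derive_off i phi).
- by move=> x; exact: is_derive_test.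
- exact: continuous_partial_test.
- by move=> x /(test_off tp)[].
- by move=> x /(test_off tp)[].
Qed.

Lemma integration_by_parts phi psi i : test_fun Omega phi -> test_fun Omega psi ->
  dotL2 phi (partial i psi) = - dotL2 (partial i phi) psi.
Proof.
move=> tp ts; apply/eqP; rewrite -subr_eq0 opprK; apply/eqP.
have Lp := L2_test tp; have Ls := L2_test ts.
have Lp' := L2_partial_test i tp; have Ls' := L2_partial_test i ts.
rewrite /dotL2 -RintegralD//; [|exact: L2_mul..].
apply: (@Rintegral_derive_off i (fun x => phi x * psi x)).
- move=> x; have := is_derive_test i x tp; have := is_derive_test i x ts => d1 d2.
  rewrite [X in _ + X]mulrC; exact: is_deriveM.
- apply: (@continuous_mulD _ E) => //; try exact: continuous_test.
    exact: continuous_partial_test.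
  exact: continuous_partial_test.
- by move=> x /(test_off tp)[-> _]; rewrite mul0r.
- by move=> x /(test_off tp)[-> ->]; rewrite !mul0r addr0.
Qed.

Lemma weak_gradient_test phi : test_fun Omega phi ->
  weak_gradient_spec Omega phi (gradient phi).
Proof.
move=> tp; split.
  by move=> i; apply/(in_Lfun2P mu mO); exact: L2v_gradient_test.
move=> psi i ts; under [in RHS]eq_Rintegral do rewrite mxE.
exact: integration_by_parts.
Qed.

Lemma H1_test phi : test_fun Omega phi -> H1 Omega phi.
Proof.
move=> tp; split; first by apply/(in_Lfun2P mu mO); exact: L2_test.
by exists (gradient phi); exact: weak_gradient_test.
Qed.

Lemma H1_L2 v : H1 Omega v -> L2 v.
Proof. by move=> [/(in_Lfun2P mu mO)]. Qed.

Lemma wgradP v : H1 Omega v -> weak_gradient_spec Omega v (wgrad Omega v).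
Proof. by move=> [_ vG]; exact: getPex. Qed.

Lemma weak_gradient_L2v v G : weak_gradient_spec Omega v G -> L2v Omega G.
Proof. by move=> [LG _] i; apply/(in_Lfun2P mu mO); exact: LG. Qed.

Lemma L2v_wgrad v : H1 Omega v -> L2v Omega (wgrad Omega v).
Proof. by move=> /wgradP/weak_gradient_L2v. Qed.

Lemma dotL2Bl f g h : L2 f -> L2 g -> L2 h ->
  dotL2 (fun x => f x - g x) h = dotL2 f h - dotL2 g h.
Proof.
move=> Lf Lg Lh; rewrite /dotL2 -RintegralB//; [|exact: L2_mul..].
by apply: eq_Rintegral => x _; rewrite mulrBl.
Qed.

(** Two weakly differentiable functions that differ by a constant have the
    same weak gradient: tested against a partial derivative, the constant
    contributes nothing. *)
Lemma weak_gradient_unique v w G H (c : R) : L2 v -> L2 w ->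
  weak_gradient_spec Omega v G -> weak_gradient_spec Omega w H ->
  {ae mu, forall x, Omega x -> v x - w x = c} ->
  {ae mu, forall x, Omega x -> G x = H x}.
Proof.
move=> Lv Lw vG wH vwc.
have LG := weak_gradient_L2v vG; have LH := weak_gradient_L2v wH.
have : {ae mu, forall x, forall i : 'I_n, Omega x -> G x ord0 i - H x ord0 i = 0}.
  apply: ae_forall_countable => i; apply: ae_eq0_open => //.
    by apply: L2_integrable; exact: L2B.
  move=> p q r pqO tr.
  have tp : test_fun Omega (tensor r).
    by apply: (test_fun_tensor _ _ pqO) => j; have [] := tr j.
  have Lt := L2_test tp; have Lt' := L2_partial_test i tp.
  have := dotL2Bl (LG i) (LH i) Lt; rewrite /dotL2 => ->.
  apply/eqP; rewrite subr_eq0 -eqr_opp; apply/eqP.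
  rewrite -(vG.2 _ _ tp) -(wH.2 _ _ tp); apply/eqP; rewrite -subr_eq0; apply/eqP.
  have := dotL2Bl Lv Lw Lt'; rewrite /dotL2 => <-.
  transitivity (\int[mu]_(x in Omega) (c * partial i (tensor r) x)).
    apply: Rintegral_ae_eq => //.
    + apply: measurable_funM; last exact: Lt'.1.
      by apply: measurable_funB; [exact: Lv.1|exact: Lw.1].
    + by apply: measurable_funM; [exact: measurable_cst|exact: Lt'.1].
    + by move: vwc; apply: filterS => x h Ox; rewrite h.
  by rewrite RintegralZl ?integral_partial_test ?mulr0//; exact: L2_integrable.
apply: filterS => x h Ox; apply/rowP => i.
by apply/eqP; rewrite -subr_eq0; apply/eqP; exact: h.
Qed.

(** Each box compactly contained in Omega admits the tensors as tests, so the
    difference is constant on it; connectedness joins the constants. *)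
Lemma weak_gradient_eq_cst v w G H : connected Omega -> L2 v -> L2 w ->
  weak_gradient_spec Omega v G -> weak_gradient_spec Omega w H ->
  {ae mu, forall x, Omega x -> G x = H x} ->
  exists c : R, {ae mu, forall x, Omega x -> v x - w x = c}.
Proof.
move=> cO Lv Lw vG wH GH.
have LG := weak_gradient_L2v vG; have LH := weak_gradient_L2v wH.
apply: connected_ae_cst => // p q pq pqO.
have pqO' : obox p q `<=` Omega by move=> x /sub_obox_cbox/pqO.
have mD : measurable (obox p q) by exact: measurable_obox.
apply: weakly_cst_ae => //.
  by apply: (integrableS mO mD pqO'); apply: L2_integrable; exact: L2B.
move=> i r tr.
have tp : test_fun Omega (tensor r).
  by apply: (test_fun_tensor _ _ pqO) => j; have [] := tr j.
have Lt := L2_test tp; have Lt' := L2_partial_test i tp.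
rewrite -(Rintegral_sub pqO'); last first.
  by move=> x xpq; rewrite (partial_tensor i tr) (tensor_off_obox (test_family_derive i tr) xpq) mulr0.
have := dotL2Bl Lv Lw Lt'; rewrite /dotL2 => ->.
rewrite (vG.2 _ _ tp) (wH.2 _ _ tp); apply/eqP; rewrite subr_eq0 eqr_opp; apply/eqP.
apply: Rintegral_ae_eq => //.
- by apply: measurable_funM; [exact: (LG i).1|exact: Lt.1].
- by apply: measurable_funM; [exact: (LH i).1|exact: Lt.1].
- by move: GH; apply: filterS => x h Ox; rewrite h.
Qed.

(** A test function approximates itself, once its weak gradient is identified
    with the classical one by uniqueness. *)
Lemma H10_test phi : test_fun Omega phi -> H10 Omega phi.
Proof.
move=> tp; have Hp := H1_test tp; split => // e e0; exists phi; split => //.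
  rewrite /norm0 Lnorm2E//; last by apply: L2B => //; exact: L2_test.
  rewrite /dotL2; under eq_Rintegral do rewrite subrr mul0r.
  by rewrite Rintegral_cst// mul0r sqrtr0 lte_fin.
have LG := L2v_wgrad Hp; have LH := L2v_gradient_test tp.
have L0 : L2v Omega (fun x => wgrad Omega phi x - gradient phi x).
  by move=> i; under eq_fun do rewrite !mxE; apply: L2B => //; exact: L2_partial_test.
rewrite norm0_vecE// (_ : dotv _ _ _ = 0) ?sqrtr0 ?lte_fin//.
have Lz : L2v Omega (fun=> 0) by move=> i; under eq_fun do rewrite mxE; exact: L2_0.
have gz : {ae mu, forall x, Omega x -> wgrad Omega phi x - gradient phi x = 0}.
  have := weak_gradient_unique (L2_test tp) (L2_test tp) (wgradP Hp) (weak_gradient_test tp) (c := 0).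
  move=> /(_ _); have z : {ae mu, forall x, Omega x -> phi x - phi x = 0}.
    by apply: aeW => x _; rewrite subrr.
  by move=> /(_ z); apply: filterS => x h Ox; rewrite h// subrr.
rewrite (dotv_ae_eq mO L0 L0 Lz Lz gz gz) /dotv.
transitivity (\int[mu]_(x in Omega) (0 : R)); last by rewrite Rintegral_cst// mul0r.
by apply: eq_Rintegral => x _; rewrite /dot big1// => i _; rewrite mxE mul0r.
Qed.

(** This makes the supremum that defines the Poincare constant range over a
    nonempty set; otherwise its value would be -oo. *)
Lemma exists_H10_neq0 : Omega !=set0 -> exists2 w, H10 Omega w & ~ ae_zero Omega w.
Proof.
move=> [x Ox]; have [p [q [xpq pqO]]] := open_rat_cbox oO Ox.
set p' := ratr \o p : 'I_n -> R in xpq pqO; set q' := ratr \o q : 'I_n -> R in xpq pqO.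
exists (tensor (bumps p' q')).
  by apply: H10_test; apply: (test_fun_tensor _ _ pqO) => j; have [] := test_family_bumps p' q' j.
move=> [N [mN N0 sN]].
have : (mu (obox p' q') <= mu N)%E.
  apply: le_measure; rewrite ?inE//; first exact: measurable_obox.
  move=> y ypq; apply: sN => /= /(_ (pqO _ (sub_obox_cbox ypq)))/eqP.
  apply/negP; rewrite gt_eqF//; apply: prodr_gt0 => j _; apply: bump_gt0.
  by move/oboxE : ypq; exact.
by rewrite N0 leNgt lebesgue_rV_obox_gt0//; exact: obox_lt xpq.
Qed.

End weak_gradients.

(** * The functional and its minimisers *)

Section functional.
Context {R : realType} {n : nat}.
Local Notation E := 'rV[R]_n.
Local Notation mu := (lebesgue_rV R n).
Variable Omega : set E.
Hypothesis oO : open Omega.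
Hypothesis bO : bounded_set Omega.
Variables (A : E -> 'M[R]_n) (alpha beta : R).
Hypothesis hA : forall i j, in_Lp Omega +oo%E (fun x => A x i j).
Hypothesis sA : {ae mu, forall x, Omega x -> (A x)^T = A x}.
Hypothesis alpha0 : 0 < alpha.
Hypothesis eA : uniformly_elliptic Omega A alpha beta.
Implicit Types (u v w f g q phi psi : E -> R) (G H : E -> E).
Local Notation L2 := (L2 mu Omega).
Local Notation dotL2 := (dotL2 mu Omega).
Local Notation energy := (energy Omega A).
Local Notation wgrad := (wgrad Omega).
Local Notation LA := (LA Omega A).

Let mO : measurable Omega := measurable_open_rV oO.

Definition nrm f : R := Num.sqrt (dotL2 f f).
Definition nrmA v : R := Num.sqrt (energy (wgrad v) (wgrad v)).

Lemma norm0E f : L2 f -> norm0 Omega f = (nrm f)%:E.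
Proof. exact: Lnorm2E. Qed.

Lemma seminormAE v : H1 Omega v -> seminormA Omega A v = (nrmA v)%:E.
Proof.
move=> /(L2v_wgrad oO) LG; rewrite /seminormA.
set I := integral _ _ _; have -> : I = (energy (wgrad v) (wgrad v))%:E; last by [].
rewrite /energy /dotv /Rintegral fineK//; apply: integrable_fin_num => //.
by apply: integrable_dot => //; exact: L2v_flux.
Qed.

Lemma nrmA_sqr v : H1 Omega v -> nrmA v ^+ 2 = energy (wgrad v) (wgrad v).
Proof. by move=> /(L2v_wgrad oO) LG; rewrite sqr_sqrtr// (energy_ge0 mO hA alpha0 eA). Qed.

Lemma LAP v : VA Omega A v -> LA_spec Omega A v (LA v).
Proof. by move=> [_ vf]; exact: getPex. Qed.

Lemma LA_L2 v : VA Omega A v -> L2 (LA v).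
Proof. by move=> /LAP[/(in_Lfun2P mu mO)]. Qed.

Lemma nrm_ae0 f : L2 f -> {ae mu, forall x, Omega x -> f x = 0} -> nrm f = 0.
Proof.
move=> Lf f0; rewrite /nrm (_ : dotL2 f f = 0) ?sqrtr0//.
rewrite /dotL2 (@Rintegral_ae_eq _ _ _ mu Omega mO _ (fun=> 0)).
- by rewrite Rintegral_cst// mul0r.
- by apply: measurable_funM; exact: Lf.1.
- exact: measurable_cst.
- by move: f0; apply: filterS => x h Ox; rewrite h// mul0r.
Qed.

Lemma nrm_eq0 f : L2 f -> nrm f = 0 -> {ae mu, forall x, Omega x -> f x = 0}.
Proof.
move=> Lf /eqP; rewrite sqrtr_eq0 => f0; apply: (Rintegral_sqr_eq0 mO Lf).
rewrite (_ : \int[mu]_(x in Omega) _ = dotL2 f f).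
  by apply/eqP; rewrite eq_le f0 dotL2_ge0.
by apply: eq_Rintegral => x _; rewrite expr2.
Qed.

(** Green's formula extends from test functions to H10 by density. *)
Lemma green v u : VA Omega A v -> H10 Omega u ->
  energy (wgrad v) (wgrad u) = - dotL2 (LA v) u.
Proof.
move=> Vv [Hu dense]; have Hv := Vv.1; have [_ Lphi] := LAP Vv.
have LGv := L2v_wgrad oO Hv; have LGu := L2v_wgrad oO Hu.
have Lu := H1_L2 oO Hu; have Lf := LA_L2 Vv; have LF := L2v_flux mO hA LGv.
apply/eqP; rewrite -addr_eq0 -normr_le0; apply/ler_addgt0Pl => e e0; rewrite addr0.
pose k := nrm (LA v) + Num.sqrt (dotv Omega (flux A (wgrad v)) (flux A (wgrad v))).
have k0 : 0 <= k by rewrite addr_ge0 ?sqrtr_ge0.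
(* Dividing by k + 1 rather than k, which may vanish. *)
have e'0 : 0 < e / (k + 1) by rewrite divr_gt0// ltr_wpDl.
have [phi [tp up Gp]] := dense _ e'0.
have Lp := L2_test oO bO tp; have LGp := L2v_gradient_test oO bO tp.
have Lup := L2B mO Lu Lp.
have LGup : L2v Omega (fun x => wgrad u x - gradient phi x).
  by have := L2v_axpy mO (-1) LGu LGp; under eq_fun do rewrite scaleN1r.
rewrite norm0E// lte_fin in up; rewrite norm0_vecE// lte_fin in Gp.
have e1 : energy (wgrad v) (wgrad u) =
    energy (wgrad v) (fun x => wgrad u x - gradient phi x) + energy (wgrad v) (gradient phi).
  rewrite -[X in _ + X]mul1r -energy_axpyr//; congr (energy _ _).
  by apply/funext => x; rewrite scale1r subrK.
have e2 : dotL2 (LA v) u = dotL2 (LA v) (fun x => u x - phi x) + dotL2 (LA v) phi.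
  by rewrite -dotL2Dr//; congr (dotL2 _ _); apply/funext => x; rewrite subrK.
have e3 : dotL2 (LA v) phi = - energy (wgrad v) (gradient phi) by exact: Lphi.
rewrite e1 e2 e3 addrACA subrr addr0.
apply: le_trans (ler_normD _ _) _.
apply: (@le_trans _ _ (k * (e / (k + 1)))); last first.
  by rewrite mulrCA ger_pMr// ler_pdivrMr ?ltr_wpDl// mul1r lerDl.
rewrite /k mulrDl addrC; apply: lerD.
  by apply: le_trans (dotL2_CS mO Lf Lup) _; rewrite ler_wpM2l ?sqrtr_ge0// ltW.
by apply: le_trans (dotv_CS mO LF LGup) _; rewrite ler_wpM2l ?sqrtr_ge0// ltW.
Qed.

Lemma not_ae_zero_nrm w : H1 Omega w -> ~ ae_zero Omega w -> 0 < nrm w.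
Proof.
move=> Hw w0; rewrite lt_neqAle sqrtr_ge0 andbT eq_sym; apply/eqP => nw.
by apply: w0; apply: nrm_eq0 => //; exact: H1_L2.
Qed.

Lemma eigen_ratioE w : H10 Omega w -> ~ ae_zero Omega w ->
  (seminormA Omega A w ^+ 2 / norm0 Omega w ^+ 2)%E = (nrmA w ^+ 2 / nrm w ^+ 2)%:E.
Proof.
move=> [Hw _] w0; have nw := not_ae_zero_nrm Hw w0.
rewrite seminormAE// norm0E//; last exact: H1_L2.
by rewrite -!EFin_expe inver sqrf_eq0 gt_eqF// -EFinM.
Qed.

Lemma lambda1_ge0 : (0 <= lambda1 Omega A)%E.
Proof.
apply: le_ereal_inf_tmp => _ [w [Hw w0] <-].
by rewrite eigen_ratioE// lee_fin divr_ge0 ?sqr_ge0.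
Qed.

(** C' is the real value of CA: finiteness of CA excludes the eigenvalue 0, and
    an infinite eigenvalue means that H10 is trivial and C' = 0. That C' is
    strictly below C decides the equality case later. *)
Lemma CA_bound (C : R) : 0 < C -> (CA Omega A < C%:E)%E ->
  exists C', [/\ 0 <= C', C' < C & forall w, H10 Omega w -> nrm w <= C' * nrmA w].
Proof.
move=> C0; rewrite /CA.
have inf w : H10 Omega w -> ~ ae_zero Omega w ->
    (lambda1 Omega A <= (nrmA w ^+ 2 / nrm w ^+ 2)%:E)%E.
  by move=> Hw w0; apply: ereal_inf_lbound; exists w => //; rewrite eigen_ratioE.
have zero w : H10 Omega w -> ae_zero Omega w -> nrm w = 0.
  by move=> [Hw _] w0; apply: nrm_ae0 => //; exact: H1_L2.
have := lambda1_ge0; case: (lambda1 Omega A) inf => [l inf|inf _|//]; last first.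
  rewrite /= invey lte_fin => _; exists 0; split => // w Hw; rewrite mul0r.
  have [w0|w0] := pselect (ae_zero Omega w); first by rewrite zero.
  by have := inf w Hw w0; rewrite leye_eq.
rewrite lee_fin => l0 /=; rewrite inver; case: eqP => [//|/eqP sl].
have l1 : 0 < Num.sqrt l by rewrite lt_neqAle eq_sym sl sqrtr_ge0.
rewrite lte_fin => lC; exists (Num.sqrt l)^-1; split; [by rewrite invr_ge0 ltW|exact: lC|].
move=> w Hw; have [w0|w0] := pselect (ae_zero Omega w).
  by rewrite zero// mulr_ge0 ?invr_ge0 ?sqrtr_ge0.
have nw := not_ae_zero_nrm Hw.1 w0.
have := inf w Hw w0; rewrite lee_fin ler_pdivlMr ?exprn_gt0// => h.
rewrite mulrC ler_pdivlMr// -(@ler_pXn2r _ 2)// ?nnegrE ?mulr_ge0 ?sqrtr_ge0//.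
by rewrite exprMn mulrC sqr_sqrtr.
Qed.

Lemma JE C q v : in_Lp Omega 2%:E q -> VA Omega A v ->
  J Omega A C q v = (C * nrm (fun x => LA v x + q x) + nrmA v)%:E.
Proof.
move=> /(in_Lfun2P mu mO) Lq Vv; rewrite /J norm0E; last first.
  by apply: L2D => //; exact: LA_L2.
by rewrite seminormAE ?EFinD ?EFinM//; exact: Vv.1.
Qed.

Section comparison.
Variables (q u v : E -> R).
Hypothesis Lq : in_Lp Omega 2%:E q.
Hypothesis Vu : VA Omega A u.
Hypothesis Hu : H10 Omega u.
Hypothesis uq : (fun x => - LA u x) = q %[ae mu in Omega].
Hypothesis Vv : VA Omega A v.

Let f x := LA v x + q x.

Let Lqq : L2 q. Proof. exact/(in_Lfun2P mu mO). Qed.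
Let Lf : L2 f. Proof. by apply: L2D => //; exact: LA_L2. Qed.
Let LGu : L2v Omega (wgrad u). Proof. exact: (L2v_wgrad oO Vu.1). Qed.
Let LGv : L2v Omega (wgrad v). Proof. exact: (L2v_wgrad oO Vv.1). Qed.
Let Lu : L2 u. Proof. exact: (H1_L2 oO Vu.1). Qed.
Let Lv : L2 v. Proof. exact: (H1_L2 oO Vv.1). Qed.

Lemma J_solution C : J Omega A C q u = (nrmA u)%:E.
Proof.
rewrite (JE C Lq Vu) (_ : nrm _ = 0) ?mulr0 ?add0r//.
apply: nrm_ae0; first by apply: L2D => //; exact: LA_L2.
by move: uq; apply: filterS => x h Ox; rewrite -h// subrr.
Qed.

Lemma dotL2_residual g : L2 g -> dotL2 f g = dotL2 (LA v) g - dotL2 (LA u) g.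
Proof.
move=> Lg; have Lu' := LA_L2 Vu; have Lv' := LA_L2 Vv.
rewrite -(dotL2Bl oO)//; apply: Rintegral_ae_eq => //.
- by apply: measurable_funM; [exact: Lf.1|exact: Lg.1].
- by apply: measurable_funM; [exact: (L2B mO Lv' Lu').1|exact: Lg.1].
- by move: uq; apply: filterS => x h Ox; rewrite /f -h.
Qed.

(** The energy of the solution splits into a mixed term and the residual of
    the competitor tested against the solution. *)
Lemma energy_solution :
  energy (wgrad u) (wgrad u) = energy (wgrad v) (wgrad u) + dotL2 f u.
Proof. by rewrite (dotL2_residual Lu) (green Vu Hu) (green Vv Hu) addKr. Qed.

(** Cauchy-Schwarz bounds both terms of the splitting, the second one through
    the Poincare type bound on u; a factor nrmA u cancels. *)
Lemma nrmA_solution_le C' : 0 <= C' -> nrm u <= C' * nrmA u ->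
  nrmA u <= nrmA v + C' * nrm f.
Proof.
move=> C'0 uC'; have [u0|u0] := leP (nrmA u) 0.
  by rewrite (le_trans u0)// addr_ge0 ?mulr_ge0 ?sqrtr_ge0.
rewrite -(ler_pM2r u0) -expr2 nrmA_sqr; last exact: Vu.1.
rewrite energy_solution mulrDl; apply: lerD.
  exact: le_trans (ler_norm _) (energy_CS mO hA sA alpha0 eA LGv LGu).
apply: le_trans (ler_norm _) _; apply: le_trans (dotL2_CS mO Lf Lu) _.
by rewrite -/(nrm f) -/(nrm u) [C' * _]mulrC -mulrA ler_wpM2l ?sqrtr_ge0.
Qed.

(** Equal seminorms and a vanishing residual force equality in the
    Cauchy-Schwarz inequality, so the gradients agree. *)
Lemma wgrad_eq_of_equality : nrm f = 0 -> nrmA v = nrmA u ->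
  {ae mu, forall x, Omega x -> wgrad v x = wgrad u x}.
Proof.
move=> f0 vu.
have uf : dotL2 f u = 0.
  apply/eqP; rewrite -normr_le0; apply: le_trans (dotL2_CS mO Lf Lu) _.
  by rewrite -/(nrm f) f0 mul0r.
have euv := energy_solution; rewrite uf addr0 in euv.
have evv : energy (wgrad v) (wgrad v) = energy (wgrad u) (wgrad u).
  by rewrite -(nrmA_sqr Vu.1) -(nrmA_sqr Vv.1) vu.
have Ld := L2v_axpy mO (-1) LGv LGu.
have : energy (fun x => wgrad v x + -1 *: wgrad u x) (fun x => wgrad v x + -1 *: wgrad u x) = 0.
  rewrite (energy_axpyr mO hA _ Ld LGv LGu).
  rewrite (energy_axpyl mO hA sA _ LGv LGv LGu) (energy_axpyl mO hA sA _ LGu LGv LGu).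
  by rewrite (energyC mO hA sA LGu LGv) evv -euv !mulN1r subrr.
move=> /(energy_eq0 mO hA alpha0 eA Ld); apply: filterS => x h Ox.
by apply/eqP; rewrite -subr_eq0 -scaleN1r h.
Qed.

(** By the definition of LA the residual tested against a tensor is the energy
    of the difference of the gradients, and the fundamental lemma applies. *)
Lemma residual_eq0 : {ae mu, forall x, Omega x -> wgrad v x = wgrad u x} ->
  nrm f = 0.
Proof.
move=> vu; apply: nrm_ae0 => //; apply: ae_eq0_open => //.
  exact: L2_integrable.
move=> p q' r pqO tr.
have tp : test_fun Omega (tensor r).
  by apply: (test_fun_tensor _ _ pqO) => j; have [] := tr j.
have ev : dotL2 (LA v) (tensor r) = - energy (wgrad v) (gradient (tensor r)).
  exact: (LAP Vv).2.
have eu : dotL2 (LA u) (tensor r) = - energy (wgrad u) (gradient (tensor r)).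
  exact: (LAP Vu).2.
apply: etrans (dotL2_residual (L2_test oO bO tp)) _.
apply: etrans (congr2 (fun a b : R => a - b) ev eu) _.
apply/eqP; rewrite subr_eq0 eqr_opp; apply/eqP.
have LGt := L2v_gradient_test oO bO tp.
apply: (dotv_ae_eq mO (L2v_flux mO hA LGv) LGt (L2v_flux mO hA LGu) LGt).
  by move: vu; apply: filterS => x h Ox; rewrite /flux h.
exact: aeW.
Qed.

Lemma nrmA_ae_eq : {ae mu, forall x, Omega x -> wgrad v x = wgrad u x} ->
  nrmA v = nrmA u.
Proof.
move=> vu; rewrite /nrmA; apply: (congr1 Num.sqrt).
apply: (dotv_ae_eq mO (L2v_flux mO hA LGv) LGv (L2v_flux mO hA LGu) LGu) => //.
by move: vu; apply: filterS => x h Ox; rewrite /flux h.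
Qed.

Lemma solution_minimises C : connected Omega -> 0 < C -> (CA Omega A < C%:E)%E ->
  (J Omega A C q u <= J Omega A C q v)%E /\
  (J Omega A C q v = J Omega A C q u <->
   exists c : R, (fun x => v x - u x) = cst c %[ae mu in Omega]).
Proof.
move=> cO C0 /(CA_bound C0)[C' [C'0 C'C /(_ u Hu) uC']].
rewrite J_solution (JE C Lq Vv) lee_fin -/f.
have arith (a b r : R) : 0 <= r -> a <= b + C' * r ->
    a <= C * r + b /\ (C * r + b = a -> r = 0 /\ b = a).
  move=> r0 ab; have rC : 0 <= (C - C') * r by rewrite mulr_ge0// subr_ge0 ltW.
  rewrite mulrBl in rC; split=> [|e]; first by lra.
  have : (C - C') * r = 0 by rewrite mulrBl; lra.
  move=> /eqP; rewrite mulf_eq0 subr_eq0 gt_eqF//= => /eqP r00; split=> //.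
  by rewrite -e r00 mulr0 add0r.
have [Ju Jeq] := arith _ _ _ (sqrtr_ge0 _) (nrmA_solution_le C'0 uC').
split; first exact: Ju.
split=> [[/Jeq[fz vu]]|[c vuc]].
  apply: (weak_gradient_eq_cst oO bO cO Lv Lu (wgradP Vv.1) (wgradP Vu.1)).
  exact: wgrad_eq_of_equality fz vu.
have vu := weak_gradient_unique oO bO Lv Lu (wgradP Vv.1) (wgradP Vu.1) vuc.
by rewrite (residual_eq0 vu) mulr0 add0r (nrmA_ae_eq vu).
Qed.

End comparison.

(** Ellipticity bounds the norm of the gradient by the seminorm up to the
    factor sqrt alpha, so every Rayleigh quotient is at least alpha / P ^ 2,
    where P is the Poincare constant. *)
Lemma CA_le_poincare : Omega !=set0 ->
  (CA Omega A <= poincare_cst Omega / (Num.sqrt alpha)%:E)%E.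
Proof.
move=> O0; have sa : 0 < Num.sqrt alpha by rewrite sqrtr_gt0.
pose nrmG w := Num.sqrt (dotv Omega (wgrad w) (wgrad w)).
have nG w : H1 Omega w -> norm0_vec Omega (wgrad w) = (nrmG w)%:E.
  by move=> Hw; rewrite norm0_vecE//; exact: L2v_wgrad.
have sup w : H10 Omega w -> ~ ae_zero Omega w ->
    ((nrm w)%:E / (nrmG w)%:E <= poincare_cst Omega)%E.
  move=> Hw w0; apply: ereal_sup_ubound; exists w => //.
  by rewrite nG ?norm0E//; [exact: (H1_L2 oO Hw.1)|exact: Hw.1].
have [w1 Hw1 w10] := exists_H10_neq0 oO bO O0.
have n1 := not_ae_zero_nrm Hw1.1 w10.
have P0 : (0 < poincare_cst Omega)%E.
  apply: lt_le_trans (sup _ Hw1 w10); rewrite inver; case: ifPn => [_|g0].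
    by rewrite gt0_muley ?lte_fin ?ltry.
  by rewrite -EFinM lte_fin divr_gt0// lt_neqAle eq_sym g0 sqrtr_ge0.
case: (poincare_cst Omega) P0 sup => [P|_ _|//]; last first.
  by rewrite inver gt_eqF// gt0_mulye ?leey// lte_fin invr_gt0.
rewrite lte_fin => P0 sup; rewrite inver gt_eqF// -EFinM.
have PG w : H10 Omega w -> ~ ae_zero Omega w -> nrm w * Num.sqrt alpha <= P * nrmA w.
  move=> Hw w0; have nw := not_ae_zero_nrm Hw.1 w0.
  have := sup w Hw w0; rewrite inver; case: ifPn => [_|g0].
    by rewrite gt0_muley ?lte_fin// leye_eq.
  have g1 : 0 < nrmG w by rewrite lt_neqAle eq_sym g0 sqrtr_ge0.
  rewrite -EFinM lee_fin ler_pdivrMr// => h.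
  apply: (@le_trans _ _ (P * nrmG w * Num.sqrt alpha)); first by rewrite ler_wpM2r// ltW.
  rewrite -mulrA; apply: ler_wpM2l; first exact: ltW.
  rewrite /nrmG -sqrtrM ?dotv_ge0// /nrmA; apply: ler_wsqrtr.
  by rewrite mulrC; apply: (energy_elliptic mO hA eA); exact: (L2v_wgrad oO Hw.1).
have l1 : (((Num.sqrt alpha / P) ^+ 2)%:E <= lambda1 Omega A)%E.
  apply: le_ereal_inf_tmp => _ [w [Hw w0] <-].
  have nw := not_ae_zero_nrm Hw.1 w0.
  rewrite eigen_ratioE// lee_fin -expr_div_n; apply: lerXn2r.
  - by rewrite nnegrE divr_ge0 ?ltW.
  - by rewrite nnegrE divr_ge0 ?sqrtr_ge0 ?ltW.
  by rewrite ler_pdivrMr// mulrAC ler_pdivlMr// mulrC (le_trans (PG w Hw w0))// mulrC.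
have aP : 0 < Num.sqrt alpha / P by rewrite divr_gt0.
rewrite /CA; have sl : ((Num.sqrt alpha / P)%:E <= sqrte (lambda1 Omega A))%E.
  have <- : sqrte ((Num.sqrt alpha / P) ^+ 2)%:E = (Num.sqrt alpha / P)%:E.
    by rewrite /= sqrtr_sqr gtr0_norm.
  by rewrite lee_sqrt// lambda1_ge0.
rewrite -[X in (_ <= X%:E)%E]invrK invf_div.
have -> : ((Num.sqrt alpha / P)^-1%:E)%E = ((Num.sqrt alpha / P)%:E^-1)%E.
  by rewrite inver gt_eqF.
by rewrite lee_pV2// inE ?sqrte_ge0// lee_fin ltW.
Qed.

End functional.

Unset Implicit Arguments.

Theorem proposition2p6 (R : realType) (n : nat) (Omega : set 'rV[R]_n.+1)
  (A : 'rV[R]_n.+1 -> 'M[R]_n.+1) (alpha beta : R) :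
  bounded_lipschitz_domain Omega ->
  (forall i j, in_Lp Omega +oo%E (fun x => A x i j)) ->
  {ae lebesgue_rV R n.+1, forall x, Omega x -> (A x)^T = A x} ->
  0 < alpha -> alpha <= beta -> uniformly_elliptic Omega A alpha beta ->
  (forall q u : 'rV[R]_n.+1 -> R,
     in_Lp Omega 2%:E q ->
     VA Omega A u -> H10 Omega u ->
     (fun x => - LA Omega A u x) = q %[ae lebesgue_rV R n.+1 in Omega] ->
     forall C : R, 0 < C -> (CA Omega A < C%:E)%E ->
     forall v : 'rV[R]_n.+1 -> R, VA Omega A v ->
       (J Omega A C q u <= J Omega A C q v)%E /\
       (J Omega A C q v = J Omega A C q u <->
        exists c : R,
          (fun x => v x - u x) = cst c %[ae lebesgue_rV R n.+1 in Omega])) /\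
  (CA Omega A <= poincare_cst Omega / (Num.sqrt alpha)%:E)%E.
Proof.
move=> [oO cO O0 bO _] hA sA alpha0 _ eA; split; last first.
  exact: (CA_le_poincare oO bO hA alpha0 eA O0).
move=> q u Lq Vu Hu uq C C0 CAC v Vv.
exact: (solution_minimises oO bO hA sA alpha0 eA Lq Vu Hu uq Vv cO C0 CAC).
Qed.
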